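(* Let $T$ be a well-covered tree of order $2n$ such that $T\not\cong P_n^{\ast}$ and $T\not\cong S_n^{\ast}$. Then $P_n^{\ast}\prec T\prec S_n^{\ast}$.
   Context: All graphs are finite, simple and undirected. A graph is well-covered if all of its maximal independent sets have the same size. The independence polynomial of a graph $G$ is $I(G,x)=\sum_{k\ge 0} i_kx^k$, where $i_k$ is the number of independent sets of size $k$ in $G$. It is known that the root of $I(G,x)$ of smallest modulus is real and lies in $[-1,0)$; it is denoted $\xi(G)$ (equivalently, the largest real root of $I(G,x)$). For graphs $G,H$, write $H\preceq G$ if and only if $I(H,x)\ge I(G,x)$ for all $x\in[\xi(G),0]$, and $H\prec G$ if and only if $H\preceq G$ and $I(H,x)\neq I(G,x)$ as polynomials. For a graph $G$, the graph star $G^{\ast}$ is obtained from $G$ by attaching, for each vertex $v$ of $G$, a new vertex $v^{\ast}$ joined by an edge to $v$ only. $P_n$ and $S_n$ denote the path and the star ($S_n=K_{1,n-1}$) of order $n$. *)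

(* Defs.v *)
From HB Require Import structures.
From mathcomp Require Import boolp classical_sets reals.
From mathcomp Require Import all_boot all_order all_algebra.
From mathcomp Require Import complex polyrcf lra.

Set Implicit Arguments.
Unset Strict Implicit.
Unset Printing Implicit Defensive.

Import Order.TTheory GRing.Theory Num.Theory.
Local Open Scope ring_scope.
Local Open Scope complex_scope.

Record sgraph := SGraph {
  svertex :> finType;
  sedge : rel svertex;
  sedge_sym : symmetric sedge;
  sedge_irrefl : irreflexive sedge }.

Definition graph_iso (G H : sgraph) : Prop :=
  exists2 f : G -> H, bijective f & {mono f : x y / sedge x y}.

Definition independent (G : sgraph) (A : {set G}) : bool :=
  [forall x in A, forall y in A, ~~ sedge x y].

Definition well_covered (G : sgraph) : Prop :=
  forall A B : {set G},
    maxset (@independent G) A -> maxset (@independent G) B -> #|A| = #|B|.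

Definition graph_connected (G : sgraph) : Prop :=
  forall x y : G, connect (@sedge G) x y.

(* A single edge x -- y already gives the ucycle [:: x; y], so only ucycles
   with at least three vertices are cycles of the graph. *)
Definition acyclic (G : sgraph) : Prop :=
  forall c : seq G, ucycle (@sedge G) c -> (size c <= 2)%N.

(* The empty graph is not a tree. *)
Definition is_tree (G : sgraph) : Prop :=
  [/\ (0 < #|G|)%N, graph_connected G & acyclic G].

Definition nb_indep (G : sgraph) (k : nat) : nat :=
  #|[set A : {set G} | independent A && (#|A| == k)]|.

Definition indep_poly (R : nzRingType) (G : sgraph) : {poly R} :=
  \poly_(k < #|G|.+1) (nb_indep G k)%:R.

(* x is a real number and, as a complex root of I(G,x), has least modulus. *)
Definition min_modulus_root (R : realType) (G : sgraph) (x : R) : Prop :=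
  root (indep_poly R[i] G) x%:C /\
  forall z : R[i], root (indep_poly R[i] G) z -> `|x%:C| <= `|z|.

(* The default value 0 is used only for the graph without vertices, see
   xi_spec below. *)
Definition xi (R : realType) (G : sgraph) : R :=
  xget 0 [set x | min_modulus_root G x]%classic.

Definition preceq (R : realType) (H G : sgraph) : Prop :=
  forall x : R, xi R G <= x <= 0 ->
    (indep_poly R G).[x] <= (indep_poly R H).[x].

Definition prec (R : realType) (H G : sgraph) : Prop :=
  preceq R H G /\ indep_poly R H <> indep_poly R G.

Section GraphStar.
Variable G : sgraph.

(* inl v is the vertex v of G and inr v is the new vertex v^*. *)
Definition star_edge (a b : G + G) : bool :=
  match a, b with
  | inl u, inl v => sedge u v
  | inl u, inr v => u == v
  | inr u, inl v => u == v
  | inr _, inr _ => false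
  end.

Lemma star_edge_sym : symmetric star_edge.
Proof. by move=> [u|u] [v|v] //=; rewrite sedge_sym. Qed.

Lemma star_edge_irrefl : irreflexive star_edge.
Proof. by case=> u //=; rewrite sedge_irrefl. Qed.

Definition graph_star : sgraph := SGraph star_edge_sym star_edge_irrefl.
End GraphStar.

Section PathsAndStars.
Variable n : nat.

Definition path_edge (i j : 'I_n) : bool :=
  (i.+1 == j :> nat) || (j.+1 == i :> nat).

Lemma path_edge_sym : symmetric path_edge.
Proof. by move=> i j; rewrite /path_edge orbC. Qed.

Lemma path_edge_irrefl : irreflexive path_edge.
Proof. by move=> i; rewrite /path_edge orbb gtn_eqF. Qed.

Definition path_graph : sgraph := SGraph path_edge_sym path_edge_irrefl.

(* The vertex 0 is the centre of S_n = K_{1,n-1}. *)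
Definition center_edge (i j : 'I_n) : bool :=
  (i == 0 :> nat) (+) (j == 0 :> nat).

Lemma center_edge_sym : symmetric center_edge.
Proof. by move=> i j; rewrite /center_edge addbC. Qed.

Lemma center_edge_irrefl : irreflexive center_edge.
Proof. by move=> i; rewrite /center_edge addbb. Qed.

Definition star_graph : sgraph := SGraph center_edge_sym center_edge_irrefl.
End PathsAndStars.

Section XiSpec.
Variable G : sgraph.
Implicit Types (U W B : {set G}) (v : G).

(* The independence polynomial of the subgraph induced by U. *)
Definition ipoly (A : nzRingType) U : {poly A} :=
  \sum_(B : {set G} | (B \subset U) && independent B) 'X^#|B|.

Lemma independentP B :
  reflect {in B &, forall u v, ~~ sedge u v} (independent B).
Proof.
apply: (iffP idP) => [/forall_inP h u v uB vB|h].
  by move/forall_inP: (h u uB) => /(_ v vB).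
by apply/forall_inP => u uB; apply/forall_inP => v vB; exact: h.
Qed.

Lemma indep_polyE (A : nzRingType) : indep_poly A G = ipoly A [set: G].
Proof.
rewrite /indep_poly /ipoly poly_def.
under [RHS]eq_bigl do rewrite subsetT.
rewrite (partition_big (fun B : {set G} => inord #|B| : 'I_(#|G|.+1)) xpredT) //=.
apply: eq_bigr => k _.
rewrite scaler_nat /nb_indep -sumr_const; apply/esym/eq_big => [B|B].
  rewrite inE; congr (_ && _).
  by rewrite -val_eqE /= inordK // ltnS max_card.
by case/andP=> _ /eqP <-; rewrite inordK // ltnS max_card.
Qed.

Lemma ipoly_set0 (A : nzRingType) : ipoly A set0 = 1.
Proof.
rewrite /ipoly (big_pred1 set0) ?cards0 ?expr0 // => B /=.
rewrite subset0; case: eqP => //= ->.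
by apply/independentP => u v; rewrite inE.
Qed.

Definition delN U v := [set u in U | (u != v) && ~~ sedge v u].

Lemma delN_sub U v : delN U v \subset U :\ v.
Proof.
by apply/subsetP => u; rewrite !inE => /and3P[-> ->].
Qed.

Lemma ipoly_rec (A : nzRingType) U v : v \in U ->
  ipoly A U = ipoly A (U :\ v) + 'X * ipoly A (delN U v).
Proof.
move=> vU; rewrite /ipoly (bigID (fun B => v \in B)) /= addrC; congr (_ + _).
  apply: eq_bigl => B; rewrite subsetD1.
  by case: (v \in B); rewrite /= ?andbT ?andbF.
rewrite mulr_sumr (reindex_onto (fun B => v |: B) (fun B => B :\ v)) /=; last first.
  by move=> B /andP[_ vB]; rewrite setD1K.
have vNB B : B \subset delN U v -> v \notin B.
  by move=> /subsetP h; apply/negP => /h; rewrite !inE eqxx andbF.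
apply: eq_big => [B|B /andP[_ /eqP]]; last first.
  move=> /setP/(_ v); rewrite !inE eqxx /= => /esym vB.
  by rewrite cardsU1 vB exprD expr1.
rewrite setU11 andbT; apply/idP/idP.
  case/andP=> /andP[]; rewrite subUset => /andP[_ sB] /independentP iB /eqP eB.
  have vB : v \notin B by rewrite -eB !inE eqxx.
  apply/andP; split; last first.
    by apply/independentP => x y xB yB; apply: iB; rewrite !inE ?xB ?yB orbT.
  apply/subsetP => x xB; rewrite !inE (subsetP sB) //=.
  rewrite iB ?andbT ?setU11 // ?inE ?xB ?orbT //.
  by apply: contraNneq vB => <-.
case/andP=> sB /independentP iB.
rewrite setU1K ?vNB // eqxx andbT subUset sub1set vU /=.
apply/andP; split.
  by apply: subset_trans sB (subset_trans (delN_sub U v) (subsetDl _ _)).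
have nb x : x \in B -> ~~ sedge v x.
  by move=> /(subsetP sB); rewrite !inE => /and3P[].
apply/independentP => x y; rewrite !inE.
move=> /predU1P[->|xB] /predU1P[->|yB]; rewrite ?sedge_irrefl ?nb //.
- by rewrite sedge_sym nb.
- exact: iB.
Qed.

Lemma map_ipoly (A B : nzRingType) (f : {rmorphism A -> B}) U :
  map_poly f (ipoly A U) = ipoly B U.
Proof.
by rewrite /ipoly rmorph_sum; apply: eq_bigr => C _; rewrite /= map_polyXn.
Qed.

Variable R : realType.
Local Notation p U := (ipoly R U).
Local Notation pc U := (ipoly R[i] U).

Lemma ipolyE_rec (A : comNzRingType) U v (x : A) : v \in U ->
  (ipoly A U).[x] = (ipoly A (U :\ v)).[x] + x * (ipoly A (delN U v)).[x].
Proof. by move=> vU; rewrite (ipoly_rec A vU) !hornerE. Qed.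

Lemma ipoly_ge1 U (x : R) : 0 <= x -> 1 <= (p U).[x].
Proof.
move=> x0; rewrite /ipoly horner_sum (bigD1 set0) /=; last first.
  by rewrite sub0set; apply/independentP => u v; rewrite inE.
by rewrite cards0 hornerXn expr0 lerDl sumr_ge0 // => B _; rewrite hornerXn exprn_ge0.
Qed.

Lemma ipoly_anti (x : R) U : x <= 0 -> (forall W, W \subset U -> 0 <= (p W).[x]) ->
  forall W, W \subset U -> (p U).[x] <= (p W).[x].
Proof.
move=> x0; have [m] := ubnP #|U|; elim: m U => // m IH U leU pos W WU.
have [->//|/eqP neWU] := W =P U.
have /properP[_ [v vU vW]] : W \proper U by rewrite properEneq neWU.
have sU' : U :\ v \subset U := subsetDl _ _.
apply: (@le_trans _ _ (p (U :\ v)).[x]).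
  rewrite (ipolyE_rec x vU) gerDl mulr_le0_ge0 // pos //.
  exact: subset_trans (delN_sub _ _) sU'.
apply: IH => //.
- by move: leU; rewrite (cardsD1 v U) vU.
- by move=> W' sW; apply: pos; exact: subset_trans sW sU'.
- by rewrite subsetD1 WU.
Qed.

Definition all_ipoly : {poly R} := \prod_(U : {set G}) p U.

Lemma root_all_ipoly x : root all_ipoly x = [exists U, root (p U) x].
Proof.
rewrite /all_ipoly; have -> : root (\prod_U p U) x = \big[orb/false]_U root (p U) x.
  apply: (big_morph (fun q => root q x)) => [q1 q2|]; first exact: rootM.
  by rewrite rootE hornerC oner_eq0.
by rewrite big_orE.
Qed.

Lemma ipoly1 v : (p [set v]).[-1] = 0.
Proof.
rewrite (@ipolyE_rec _ _ v) ?set11 // setDv ipoly_set0.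
have -> : delN [set v] v = set0.
  by apply/setP => u; rewrite !inE; case: eqP.
by rewrite ipoly_set0 !hornerE; lra.
Qed.

Lemma good_root : (0 < #|G|)%N ->
  exists x0 : R, [/\ -1 <= x0, x0 < 0, (p [set: G]).[x0] = 0 &
    forall x, x0 < x -> forall U, 0 < (p U).[x]].
Proof.
case/card_gt0P => v _.
have Qm1 : root all_ipoly (-1).
  by rewrite root_all_ipoly; apply/existsP; exists [set v]; rewrite rootE ipoly1.
have Qge0 x : 0 <= x -> ~~ root all_ipoly x.
  move=> x0; rewrite root_all_ipoly; apply/existsP => -[U]; rewrite rootE => /eqP h.
  by have := ipoly_ge1 U x0; rewrite h ler10.
have [x0 [le1 lt0 rx0 nox0]] : exists x0 : R, [/\ -1 <= x0, x0 < 0, root all_ipoly x0 &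
    forall x, x0 < x -> x < 0 -> ~~ root all_ipoly x].
  have hm1 : (-1 : R) \in `](-2), 0[ by rewrite in_itv /=; apply/andP; split; lra.
  have := prev_rootP all_ipoly (-2) 0; case.
  - by move=> Q0; have := Qge0 0 (lexx _); rewrite Q0 root0.
  - move=> y _ Qy; rewrite in_itv /= => /andP[_ y0] noy; exists y; split => //.
    + by rewrite leNgt; apply/negP => y1; have := noy (-1); rewrite in_itv /= y1 ltrN10 => /(_ isT); rewrite Qm1.
    + by rewrite rootE Qy.
    + by move=> x yx x00; apply: noy; rewrite in_itv /= yx.
  - by move=> c _ _ /(_ _ hm1); rewrite Qm1.
have nor x U : x0 < x -> (p U).[x] != 0.
  move=> hx; have : ~~ root all_ipoly x.
    by case: (ltP x 0) => [|/Qge0//]; exact: nox0.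
  by rewrite root_all_ipoly negb_exists => /forallP /(_ U).
have pos x U : x0 < x -> 0 < (p U).[x].
  move=> hx; case: (ltrP 0 (p U).[x]) => // hle.
  have [x00|x00] := leP 0 x.
    by have := lt_le_trans ltr01 (le_trans (ipoly_ge1 U x00) hle); rewrite ltxx.
  have p0 : 0 <= (p U).[0] by apply: le_trans ler01 (ipoly_ge1 U (lexx 0)).
  have /(poly_ivt (ltW x00))[y] : (p U).[x] <= 0 <= (p U).[0] by rewrite hle.
  move=> /andP[xy _] /rootP py.
  by have := nor y U (lt_le_trans hx xy); rewrite py eqxx.
have ge0 U : 0 <= (p U).[x0].
  rewrite leNgt; apply/negP => hlt.
  have p0 : 0 < (p U).[0] by apply: lt_le_trans ltr01 (ipoly_ge1 U (lexx 0)).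
  have hm : (p U).[x0] * (p U).[0] < 0 by rewrite pmulr_llt0.
  have [y] := poly_ivtoo (ltW lt0) hm.
  by rewrite in_itv /= => /andP[xy _]; rewrite rootE (negPf (nor _ _ _)).
exists x0; split => // [|x hx U]; last exact: pos.
move: rx0; rewrite root_all_ipoly => /existsP[U]; rewrite rootE => /eqP pU.
apply: le_anti; rewrite ge0 andbT -pU.
by apply: ipoly_anti (ltW lt0) _ _ (subsetT _) => W _.
Qed.

Import Normc.

Lemma normcE' (z : R[i]) : `|z| = (normc z)%:C. Proof. by []. Qed.

Lemma normc_ge0 (z : R[i]) : 0 <= normc z.
Proof. by rewrite -lecR -normcE' normr_ge0. Qed.

Lemma ler_normcD (x y : R[i]) : normc x - normc y <= normc (x + y).
Proof.
have := le_normcD (x + y : R[i]) (- y); rewrite addrK normcN; lra.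
Qed.

Lemma modulus_step (r a a' d d' u u' w w' : R) :
  0 <= r -> 0 < a -> 0 < w -> 0 < u ->
  a * d' <= a' * d -> a * w' <= a' * w -> u = a + - r * d -> a' - r * d' <= u' ->
  u * w' <= u' * w.
Proof.
move=> r0 a0 w0 u0 h1 h2 ue h3; rewrite -(ler_pM2l a0).
have k1 := ler_wpM2r (ltW a0) h3.
have k2 := ler_wpM2l r0 h1.
have k3 := ler_wpM2l (ltW u0) h2.
have h4 : u * a' <= u' * a by rewrite ue; lra.
have k4 := ler_wpM2l (ltW w0) h4.
lra.
Qed.

Lemma ipoly_modulus (z : R[i]) : (forall U, 0 < (p U).[- normc z]) ->
  forall U W, W \subset U ->
  (p U).[- normc z] * normc (pc W).[z] <= normc (pc U).[z] * (p W).[- normc z].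
Proof.
move=> pos U; set r := normc z in pos *.
have [m] := ubnP #|U|; elim: m U => // m IH U leU W WU.
have [->|/eqP neWU] := W =P U; first by rewrite mulrC lexx.
have /properP[_ [v vU vW]] : W \proper U by rewrite properEneq neWU.
have leU' : (#|U :\ v| < m)%N by move: leU; rewrite (cardsD1 v U) vU.
have h1 := IH _ leU' _ (delN_sub U v).
have WU' : W \subset U :\ v by rewrite subsetD1 WU.
have h2 := IH _ leU' W WU'.
have := ler_normcD (pc (U :\ v)).[z] (z * (pc (delN U v)).[z]).
rewrite -(ipolyE_rec z vU) normcM -/r.
have := ipolyE_rec (- r) vU.
move=> ue h3; exact: modulus_step (normc_ge0 z) (pos _) (pos _) (pos _) h1 h2 ue h3.
Qed.

Lemma xi_exists : (0 < #|G|)%N ->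
  exists x0 : R, [/\ min_modulus_root G x0, -1 <= x0, x0 < 0 &
    forall x, root (indep_poly R G) x -> x <= x0].
Proof.
move=> /good_root[x0 [le1 lt0 px0 pos]]; exists x0; split => //; last first.
  move=> x; rewrite indep_polyE rootE => /eqP px; rewrite leNgt.
  by apply/negP => /pos /(_ [set: G]); rewrite px ltxx.
rewrite /min_modulus_root indep_polyE; split.
  by rewrite -(map_ipoly (real_complex R)) fmorph_root rootE px0.
move=> z; rewrite rootE => /eqP pz.
rewrite !normcE' lecR leNgt; apply/negP => hz.
have x0r : normc x0%:C = - x0.
  by rewrite /= expr0n addr0 sqrtr_sqr ltr0_norm.
have posz U : 0 < (p U).[- normc z].
  by apply: pos; rewrite -(opprK x0) ltrN2 -x0r.
have := ipoly_modulus posz (sub0set [set: G]).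
rewrite pz normc0 mul0r !ipoly_set0 hornerC normc1 mulr1.
by rewrite leNgt posz.
Qed.

(* For a graph with a vertex, xi R G is the root of least modulus, it lies in
   [-1, 0[, and it is also the largest real root. *)
Lemma xi_spec : (0 < #|G|)%N ->
  [/\ min_modulus_root G (xi R G), root (indep_poly R G) (xi R G),
      -1 <= xi R G < 0 & forall x, root (indep_poly R G) x -> x <= xi R G].
Proof.
move=> /xi_exists[x0 [mx0 le1 lt0 maxx0]].
have rootC x : root (indep_poly R[i] G) x%:C = root (indep_poly R G) x.
  by rewrite !indep_polyE -(map_ipoly (real_complex R)) fmorph_root.
suff -> : xi R G = x0 by rewrite le1 lt0 -rootC; split => //; case: mx0.
apply: xget_unique => // y [ry miny].
have yx : y <= x0 by apply: maxx0; rewrite -rootC.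
apply: le_anti; rewrite yx /=; move: (miny _ mx0.1).
rewrite !normcE' lecR /= !expr0n !addr0 !sqrtr_sqr !ltr0_norm ?lerN2 //.
exact: le_lt_trans lt0.
Qed.

End XiSpec.

(* Main.v *)
Require Import Defs.
From mathcomp Require Import all_boot all_order all_algebra.
From mathcomp Require Import reals.
From mathcomp Require Import polyrcf zify ring lra.

(* A well-covered tree of order [2n] is [G^*] for a tree [G] of order [n]; since
   [I(G^*, x) = (1+x)^n I(G, y)] with [y = x/(1+x)], it suffices to compare
   [I(P_n, y)], [I(G, y)] and [I(S_n, y)] for [y < 0], where all induced
   subgraphs have nonnegative values.

   Path: cut the tree at an edge joining the roots of [T1] and [T2]. With
   [t = -y], [B(T)] the value after deleting the closed neighbourhood of the root
   and [l = t B/I], one has [I(T) = I(T1) I(T2) (1 - l(T1) l(T2))], and [l(T)] is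
   increasing in [l(T1)] and [l(T2)]. Induction then shows that paths rooted at
   an end maximize [I] and minimize [l].

   Star: delete a leaf [v] with neighbour [u]; the forest left by deleting [u] and
   [v] has value at most [(1+y)^(n-2)], and [I(S_n, y) = (1+y)^(n-1) + y].

   The equality cases of these bounds give the strictness. *)

Set Implicit Arguments.
Unset Strict Implicit.
Unset Printing Implicit Defensive.

(** * Acyclic graphs *)

Lemma connect_invariant (T : finType) (e : rel T) (P : pred T) (x y : T) :
  (forall a b, e a b -> P a -> P b) -> connect e x y -> P x -> P y.
Proof.
move=> clP /connectP[p]; elim: p x => [|z p IH] x /=; first by move=> _ ->.
by move=> /andP[exz pz] yE Px; apply: IH pz yE _; exact: clP exz Px.
Qed.

Section Forests.
Variable G : sgraph.
Implicit Types (U W : {set G}) (u v x y : G).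

Definition edge_in U x y := [&& x \in U, y \in U & sedge x y].

Definition nbhd U v := [set x in U | sedge v x].

Definition component U v := [set x | connect (edge_in U) v x].

Lemma edge_in_sym U : connect_sym (edge_in U).
Proof.
apply: sym_connect_sym => x y; rewrite /edge_in sedge_sym.
by case: (x \in U); case: (y \in U).
Qed.

Lemma component_sub U v : v \in U -> component U v \subset U.
Proof.
move=> vU; apply/subsetP => x; rewrite inE => /connect_invariant.
by apply=> // a b /and3P[].
Qed.

Lemma connect_mono U W x y : U \subset W ->
  connect (edge_in U) x y -> connect (edge_in W) x y.
Proof.
move=> /subsetP sUW; apply: connect_sub => a b /and3P[aU bU ab].
by apply: connect1; rewrite /edge_in !sUW.
Qed.

Lemma component_edge U v x y :
  x \in component U v -> x \in U -> y \in U -> sedge x y -> y \in component U v.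
Proof.
rewrite !inE => vx xU yU xy; apply: connect_trans vx (connect1 _).
by rewrite /edge_in xU yU.
Qed.

Lemma connect_inside U W x y : connect (edge_in U) x y -> x \in W ->
  (forall a b, edge_in U a b -> a \in W -> b \in W) ->
  connect (edge_in W) x y.
Proof.
move=> xy xW clW.
suff /andP[]: (y \in W) && connect (edge_in W) x y by [].
apply: (connect_invariant (P := fun z => (z \in W) && connect (edge_in W) x z) _ xy); last by rewrite xW connect0.
move=> a b ab /andP[aW xa]; rewrite (clW _ _ ab aW) /=.
apply: connect_trans xa (connect1 _); rewrite /edge_in aW (clW _ _ ab aW).
by case/and3P: ab.
Qed.

Hypothesis G_acyclic : acyclic G.

(** A duplicate-free path from [a] to [b] avoiding [u] closes up through [u]; acyclicity leaves only
    the trivial path. *)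
Lemma acyclic_connect U u a b : sedge u a -> sedge u b -> u \notin U ->
  connect (edge_in U) a b -> a = b.
Proof.
move=> ua ub uU /connectP[p0 p0P bE]; rewrite {b}bE in ub *.
case/shortenP: p0P ub => p pP up _ ub.
have uNp : u \notin p.
  have /allP h : all (mem U) p.
    by elim: p a pP {ua up ub} => //= y p IH a /andP[/and3P[_ -> _]] /IH.
  by apply/negP => /h; rewrite /= (negPf uU).
have pE : path (@sedge G) a p.
  by apply: sub_path pP => x y /and3P[].
have uNa : u != a by apply: contraTneq ua => ->; rewrite sedge_irrefl.
have /G_acyclic : ucycle (@sedge G) [:: u, a & p].
  rewrite /ucycle /cycle /= ua rcons_path pE /= sedge_sym ub /=.
  by move: up => /= ->; rewrite inE negb_or uNa uNp.
by case: p {pP pE up uNp ub}.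
Qed.

(** Walk away from [u]: if [a] has another neighbour [b], continue with the edge [a b]. By
    acyclicity the component of [b] in [U :\ a] avoids [u], so it lies in that of [a] in [U :\ u]
    and misses [a]: the part ahead shrinks. *)
Lemma edge_degree_le1 U u a : sedge u a -> u \in U -> a \in U ->
  exists2 v, v \in U & (#|nbhd U v| <= 1)%N.
Proof.
have [m] := ubnP #|component (U :\ u) a|; elim: m u a => // m IH u a lem ua uU aU.
have aUu : a \in U :\ u.
  by rewrite !inE aU andbT; apply: contraTneq ua => ->; rewrite sedge_irrefl.
have [dega|] := leqP #|nbhd U a| 1; first by exists a.
have una : u \in nbhd U a by rewrite inE uU sedge_sym.
rewrite (cardsD1 u) una ltnS => /card_gt0P[b]; rewrite !inE => /and3P[bu bU ab].
apply: (IH a b) => //; rewrite -ltnS (leq_trans _ lem) // ltnS.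
have bUa : b \in U :\ a.
  by rewrite !inE bU andbT; apply: contraTneq ab => ->; rewrite sedge_irrefl.
have uNb : u \notin component (U :\ a) b.
  apply/negP; rewrite inE => bu'; case/negP: bu; apply/eqP.
  by apply: (@acyclic_connect (U :\ a) a b u) => //; rewrite ?inE ?eqxx // sedge_sym.
apply: proper_card; apply/properP; split; last first.
  exists a; first by rewrite inE connect0.
  by apply/negP => /(subsetP (component_sub bUa)); rewrite !inE eqxx.
apply/subsetP => x; rewrite inE => bx; rewrite inE.
apply: (connect_trans (y := b)).
  by apply: connect1; rewrite /edge_in aUu !inE bu bU.
apply: connect_mono (connect_inside (W := component (U :\ a) b) bx _ _).
- apply/subsetP => z zC; rewrite !inE; have := subsetP (component_sub bUa) _ zC.
  by rewrite !inE => /andP[_ ->]; rewrite andbT; apply: contraNneq uNb => <-.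
- by rewrite inE connect0.
- by move=> z w /and3P[zU wU zw] zC; apply: component_edge zC zU wU zw.
Qed.

Lemma forest_degree_le1 U : U != set0 ->
  exists2 v, v \in U & (#|nbhd U v| <= 1)%N.
Proof.
case/set0Pn => u uU; have [degu|] := leqP #|nbhd U u| 1; first by exists u.
move=> /ltnW/card_gt0P[a]; rewrite inE => /andP[aU ua].
exact: edge_degree_le1 ua uU aU.
Qed.

End Forests.

(** Cutting at an edge between two roots is the recursion on which the comparison with paths runs.
    The root of [U] stays the root, so [W] is a whole branch. *)
Inductive rooted_tree (G : sgraph) : {set G} -> G -> Prop :=
| rooted_tree1 r : rooted_tree [set r] r
| rooted_tree_join (U W : {set G}) (r s : G) :
    rooted_tree U r -> rooted_tree W s -> [disjoint U & W] ->
    sedge r s -> {in U & W, forall x y, sedge x y -> x = r /\ y = s} ->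
    rooted_tree (U :|: W) r.

Lemma rooted_tree_root (G : sgraph) (U : {set G}) r : rooted_tree U r -> r \in U.
Proof. by elim=> [x|V W x y _ xV _ _ _ _ _]; rewrite inE ?xV. Qed.

(** Split off the branch [W] at a neighbour [s] of the root; acyclicity makes [r s] the only edge
    between [W] and the rest. *)
Lemma connected_rooted_tree (G : sgraph) (U : {set G}) r :
  acyclic G -> r \in U -> {in U, forall x, connect (edge_in U) r x} ->
  rooted_tree U r.
Proof.
move=> acG; have [m] := ubnP #|U|; elim: m U r => // m IH U r leU rU cU.
have [->|neU] := eqVneq U [set r]; first exact: rooted_tree1.
have [s sU rs] : exists2 s, s \in U & sedge r s.
  have [s|nors] := pickP [pred s | (s \in U) && sedge r s].
    by case/andP=> *; exists s.
  case/eqP: neU; apply/setP => x; rewrite inE; apply/idP/eqP => [xU|->//].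
  have /connect_invariant h := cU x xU.
  apply/eqP; apply: (h (pred1 r)); rewrite /= ?eqxx //.
  move=> a b /and3P[_ bU ab] /eqP ar; have := nors b; rewrite /= bU -ar ab //.
set W := component (U :\ r) s.
have sUr : s \in U :\ r.
  by rewrite !inE sU andbT; apply: contraTneq rs => ->; rewrite sedge_irrefl.
have WUr : W \subset U :\ r by apply: component_sub.
have WU : W \subset U by apply: subset_trans WUr (subsetDl _ _).
have rW : r \notin W by apply/negP => /(subsetP WUr); rewrite !inE eqxx.
have clW x y : x \in U -> x \notin W -> y \in W -> sedge x y -> x = r.
  move=> xU xW yW xy; apply: contraNeq xW => xr.
  apply: component_edge yW (subsetP WUr _ yW) _ _; first by rewrite !inE xr xU.
  by rewrite sedge_sym.
have -> : U = (U :\: W) :|: W.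
  apply/setP => x; rewrite in_setU in_setD.
  by case: (boolP (x \in W)) => [/(subsetP WU) ->|]; rewrite ?orbT ?orbF.
apply: (rooted_tree_join (s := s)) => //.
- apply: IH.
  + rewrite -ltnS (leq_trans _ leU) // ltnS.
    apply: proper_card; apply/properP; split; first exact: subsetDl.
    by exists s => //; rewrite inE inE connect0.
  + by rewrite in_setD rW.
  + move=> x; rewrite inE => /andP[xW xU].
    (* A walk from [r] can leave [W] only by returning to [r], so vertices outside [W] are reached
       without using [W]. *)
    have := connect_invariant
      (P := fun z => (z \in W) || connect (edge_in (U :\: W)) r z) _ (cU x xU).
    rewrite (negPf xW) connect0 orbT /=; apply=> // a b /and3P[aU bU ab].
    have [//|bW /=] := boolP (b \in W).
    have [aW _|aW /= ra] := boolP (a \in W).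
      by rewrite (clW b a) // sedge_sym.
    by apply: connect_trans ra (connect1 _); rewrite /edge_in !in_setD aW bW aU bU.
- apply: IH.
  + rewrite -ltnS (leq_trans _ leU) // ltnS.
    by apply: proper_card; apply/properP; split => //; exists r.
  + by rewrite inE connect0.
  + move=> x xW; apply: (connect_inside (U := U :\ r)).
    * by rewrite inE in xW.
    * by rewrite inE connect0.
    * by move=> a b /and3P[aU bU ab] aW; apply: component_edge aW aU bU ab.
- by rewrite -setI_eq0 setDE -setIA (setIC _ W) setICr setI0.
- move=> x y; rewrite inE => /andP[xW xU] yW xy.
  have xr := clW x y xU xW yW xy; split => //; apply/esym.
  apply: (acyclic_connect (u := r) (U := U :\ r) acG) => //.
  + by rewrite -xr.
  + by rewrite !inE eqxx.
  + by rewrite inE in yW.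
Qed.

(** * Well-covered trees *)

(** This makes the graph the graph star of its subgraph induced by [C], with [lf c] as the new
    vertex at [c], while everything stays inside one vertex set. *)
Definition pendant_core (G : sgraph) (C : {set G}) (lf : G -> G) : Prop :=
  lf @: C = ~: C /\ {in C, forall c z, sedge (lf c) z = (z == c)}.

Section PendantCore.
Variables (G : sgraph) (C : {set G}) (lf : G -> G).
Hypothesis core : pendant_core C lf.
Local Notation lfC := (proj1 core).
Local Notation Nlf := (proj2 core).

Lemma pendant_notin c : c \in C -> lf c \notin C.
Proof. by move=> cC; rewrite -in_setC -lfC imset_f. Qed.

Lemma pendant_inj : {in C &, injective lf}.
Proof.
move=> c d cC dC /(congr1 (fun z : G => sedge z c)); rewrite !Nlf // eqxx.
by move/esym/eqP.
Qed.

Lemma card_pendant_core : #|G| = (2 * #|C|)%N.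
Proof.
have := cardsC C; rewrite -lfC card_in_imset; last exact: pendant_inj.
by move=> <-; rewrite mul2n addnn.
Qed.

End PendantCore.

Section WellCovered.
Variable G : sgraph.
Hypotheses (G_acyclic : acyclic G) (G_wc : well_covered G).
Implicit Types (A B M : {set G}) (u v w : G).

Lemma well_covered_card A M :
  independent A -> maxset (@independent G) M -> #|A| <= #|M|.
Proof.
move=> /maxset_exists[B mB /subset_leq_card AB] mM.
by rewrite (G_wc mM mB).
Qed.

Lemma independent_subset A B : A \subset B -> independent B -> independent A.
Proof.
move=> /subsetP AB /independentP iB; apply/independentP => x y xA yA.
by apply: iB; apply: AB.
Qed.

(** In a maximal independent set containing [u], exchanging [u] for two pendant neighbours would
    give a larger independent set. *)
Lemma pendant_unique u v w : sedge u v -> sedge u w ->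
  (forall z, sedge v z -> z = u) -> (forall z, sedge w z -> z = u) -> v = w.
Proof.
move=> uv uw Nv Nw; apply/eqP; apply: contraT => nvw.
have [M mM] : {M | maxset (@independent G) M & [set u] \subset M}.
  apply: maxset_exists; apply/independentP => x y /set1P -> /set1P ->.
  by rewrite sedge_irrefl.
rewrite sub1set => uM.
have /independentP iM := maxsetp mM.
have vM : v \notin M by apply: contraL uv => /(iM _ _ uM).
have wM : w \notin M by apply: contraL uw => /(iM _ _ uM).
have : independent (v |: (w |: M :\ u)).
  have key a b : (forall z, sedge a z -> z = u) -> b \in v |: (w |: M :\ u) ->
      ~~ sedge a b.
    move=> Na bM; apply/negP => /Na bu; move: bM; rewrite bu !inE eqxx /= orbF.
    by case/orP => /eqP ue; [move: uv|move: uw]; rewrite -ue sedge_irrefl.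
  apply/independentP => a b aM bM.
  have [->|av] := eqVneq a v; first exact: key.
  have [->|aw] := eqVneq a w; first exact: key.
  have [->|bv] := eqVneq b v; first by rewrite sedge_sym key.
  have [->|bw] := eqVneq b w; first by rewrite sedge_sym key.
  move: aM bM; rewrite !inE (negPf av) (negPf aw) (negPf bv) (negPf bw) /=.
  by move=> /andP[_ aM] /andP[_ bM]; apply: iM.
move=> /well_covered_card/(_ mM).
rewrite !cardsU1 !inE (negPf nvw) (negPf vM) (negPf wM) !andbF (cardsD1 u M) uM.
lia.
Qed.

(* Otherwise every neighbour [w] of [u] has a further neighbour [z w]. Take
   maximal independent sets [M1], containing [w1] and the other [z w], and [M2],
   containing [w2] and [z w1]. Exchanging their traces on the component [C] of
   [w1] in [G - u] keeps them independent and leaves room for [u] in one of the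
   two new sets, so the four sizes contradict well-coveredness. *)
Lemma pendant_exists u w1 w2 : sedge u w1 -> sedge u w2 -> w1 != w2 ->
  exists2 v, sedge u v & forall z, sedge v z -> z = u.
Proof.
move=> uw1 uw2 nw12.
(* By [zP] below, the default [v] does not occur for neighbours [v] of [u] once none of them is
   pendant. *)
pose z v := odflt v [pick x | sedge v x && (x != u)].
have [v /andP[uv /forallP Nv]|nopend] :=
    pickP [pred v | sedge u v && [forall x, sedge v x ==> (x == u)]].
  by exists v => // x vx; apply/eqP; have /implyP := Nv x; apply.
have zP v : sedge u v -> sedge v (z v) /\ z v != u.
  move=> uv; rewrite /z; case: pickP => [x /andP[]//|noz].
  have := nopend v; rewrite /= uv /= => /negP[]; apply/forallP => x.
  by apply/implyP => vx; have := noz x; rewrite vx /= => /negbFE.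
pose Y := ~: [set u].
have uY : u \notin Y by rewrite !inE eqxx.
(* Distinct neighbours of [u] lie in different components of the graph without [u]. This is what
   makes the sets prescribed for [M1] and [M2] independent. *)
have uniqN a b : sedge u a -> sedge u b -> connect (edge_in Y) a b -> a = b.
  by move=> ua ub; apply: (acyclic_connect G_acyclic ua ub uY).
have NY v : sedge u v -> v \in Y.
  by move=> uv; rewrite !inE; apply: contraTneq uv => ->; rewrite sedge_irrefl.
have eY a b : a \in Y -> b \in Y -> sedge a b -> connect (edge_in Y) a b.
  by move=> aY bY ab; apply: connect1; rewrite /edge_in aY bY.
have zY v : sedge u v -> z v \in Y by move=> /zP[_]; rewrite !inE.
have cz v : sedge u v -> connect (edge_in Y) v (z v).
  by move=> uv; apply: eY (NY _ uv) (zY _ uv) (proj1 (zP _ uv)).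
have wz v w : sedge u v -> sedge u w -> sedge v (z w) -> v = w.
  move=> uv uw vz; apply: uniqN => //; apply: connect_trans (eY _ _ _ _ vz) _.
  - exact: NY.
  - exact: zY.
  - by rewrite edge_in_sym cz.
have zz v w : sedge u v -> sedge u w -> sedge (z v) (z w) -> v = w.
  move=> uv uw vz; apply: uniqN => //; apply: connect_trans (cz _ uv) _.
  apply: connect_trans (eY _ _ _ _ vz) _; try exact: zY.
  by rewrite edge_in_sym cz.
have [M1 mM1 sM1] : {M | maxset (@independent G) M &
    w1 |: [set z v | v in [set v | sedge u v] :\ w1] \subset M}.
  apply: maxset_exists; apply/independentP => a b; rewrite !inE.
  move=> /predU1P[->|/imsetP[v + ->]] /predU1P[->|/imsetP[w + ->]].
  - by rewrite sedge_irrefl.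
  - rewrite !inE => /andP[+ uw]; apply: contraNN => h.
    by apply/eqP/esym; apply: wz h.
  - rewrite !inE => /andP[+ uv]; rewrite sedge_sym; apply: contraNN => h.
    by apply/eqP/esym; apply: wz h.
  - rewrite !inE => /andP[_ uv] /andP[_ uw]; apply/negP => h.
    by have vw := zz _ _ uv uw h; move: h; rewrite vw sedge_irrefl.
have [M2 mM2 sM2] : {M | maxset (@independent G) M & [set w2; z w1] \subset M}.
  apply: maxset_exists; apply/independentP => a b.
  have nz : ~~ sedge w2 (z w1).
    by apply: contraNN nw12 => /wz h; rewrite h.
  move=> /set2P[->|->] /set2P[->|->]; rewrite ?sedge_irrefl // ?nz //.
  by rewrite sedge_sym nz.
have /independentP iM1 := maxsetp mM1.
have /independentP iM2 := maxsetp mM2.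
have w1M1 : w1 \in M1 by apply: (subsetP sM1); rewrite !inE eqxx.
have NM1 v : sedge u v -> v != w1 -> v \notin M1.
  move=> uv vw; have zM : z v \in M1.
    by apply: (subsetP sM1); rewrite inE; apply/orP; right;
      apply: imset_f; rewrite !inE vw.
  by apply: contraL (proj1 (zP _ uv)) => vM; apply: iM1.
have [w2M2 zM2] : w2 \in M2 /\ z w1 \in M2.
  by split; apply: (subsetP sM2); rewrite !inE eqxx ?orbT.
have w1M2 : w1 \notin M2.
  by apply: contraL (proj1 (zP _ uw1)) => vM; apply: iM2.
have uM1 : u \notin M1 by apply: contraL uw1 => uM; apply: iM1.
have uM2 : u \notin M2 by apply: contraL uw2 => uM; apply: iM2.
pose C := component Y w1.
have CY : C \subset Y by apply: component_sub; exact: NY.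
have uC : u \notin C by apply/negP => /(subsetP CY); rewrite (negPf uY).
have NC v : v \in C -> sedge u v -> v = w1.
  by rewrite inE => w1v uv; apply/esym; apply: uniqN.
have cross a b : a \in C -> b \notin C -> sedge a b -> b = u /\ a = w1.
  move=> aC bC ab; have bu : b = u.
    apply/eqP; apply: contraNT bC => bu.
    by apply: component_edge aC (subsetP CY _ aC) _ ab; rewrite !inE.
  by split=> //; apply: NC => //; rewrite -bu sedge_sym.
(* By [cross], [u w1] is the only edge leaving [C], so independent sets can be glued along [C]
   unless the result contains both its ends. *)
have mix A B : independent A -> independent B -> (u \notin B) || (w1 \notin A) ->
    independent ((A :&: C) :|: (B :\: C)).
  move=> /independentP iA /independentP iB ok.
  have nc a b : a \in A -> a \in C -> b \in B -> b \notin C -> ~~ sedge a b.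
    move=> aA aC bB bC; apply/negP => /(cross _ _ aC bC)[bu aw].
    by move: ok; rewrite -bu -aw aA bB.
  apply/independentP => a b; rewrite !in_setU !in_setI !in_setD.
  case/orP => /andP[h1 h2] /orP[] /andP[h3 h4].
  - by apply: iA.
  - by apply: nc.
  - by rewrite sedge_sym nc.
  - by apply: iB.
have card_mix A B : #|(A :&: C) :|: (B :\: C)| = #|A :&: C| + #|B :\: C|.
  apply/eqP; rewrite (leq_card_setU _ _).2 -setI_eq0; apply/eqP.
  by apply/setP => x; rewrite !in_setI in_setD in_set0; case: (x \in C); rewrite /= ?andbF.
have I1 : independent ((M1 :&: C) :|: (M2 :\: C)).
  by apply: mix; rewrite ?uM2 ?(maxsetp mM1) ?(maxsetp mM2).
have I2 : independent (u |: ((M2 :&: C) :|: (M1 :\: C))).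
  have nu a : a \in (M2 :&: C) :|: (M1 :\: C) -> ~~ sedge u a.
    rewrite in_setU in_setI in_setD => h; apply/negP => ua; case/orP: h => /andP[h1 h2].
      by have aw := NC _ h2 ua; rewrite aw (negPf w1M2) in h1.
    have [aw|aw] := eqVneq a w1; last by rewrite (negPf (NM1 _ ua aw)) in h2.
    by move: h1; rewrite aw inE connect0.
  have : independent ((M2 :&: C) :|: (M1 :\: C)).
    by apply: mix; rewrite ?uM1 ?(maxsetp mM1) ?(maxsetp mM2).
  move=> /independentP iM; apply/independentP => a b.
  move=> /setU1P[->|aM] /setU1P[->|bM]; rewrite ?sedge_irrefl ?nu //.
    by rewrite sedge_sym nu.
  exact: iM.
(* The two mixed sets have [|M1| + |M2| + 1] elements together, yet each has at most
   [|M1| = |M2|]. *)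
have := well_covered_card I1 mM1; have := well_covered_card I2 mM1.
rewrite cardsU1 !card_mix in_setU in_setI in_setD (negPf uM1) (negPf uM2) (negPf uC) /=.
have := G_wc mM1 mM2; have := cardsID C M1; have := cardsID C M2.
by move: #|_ :&: _| #|_ :\: _| #|_ :&: _| #|_ :\: _| #|M1| #|M2|; clear; lia.
Qed.

End WellCovered.

(** From order three on, the core consists of the vertices of degree at least two; [pendant_exists]
    and [pendant_unique] give each of them exactly one pendant neighbour. *)
Lemma well_covered_pendant_core (G : sgraph) :
  is_tree G -> well_covered G -> 1 < #|G| ->
  exists (C : {set G}) (lf : G -> G), pendant_core C lf.
Proof.
case=> _ conG acG wcG G2.
have exN (x : G) : exists y, sedge x y.
  have [y|noy] := pickP (sedge x); first by exists y.
  move: G2; rewrite -cardsT (cardsD1 x) inE ltnS => /card_gt0P[y].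
  rewrite !inE => /andP[yx _].
  have : (pred1 x) y.
    apply: (connect_invariant _ (conG x y)) => /=; last by rewrite eqxx.
    by move=> a b ab /eqP ax; have := noy b; rewrite -ax ab.
  by rewrite /= (negPf yx).
(* In order two no vertex has degree two; either vertex can serve as the core. *)
have [G3|G3] := leqP #|G| 2.
  have /card_gt0P[a _] : 0 < #|G| by lia.
  have [b ab] := exN a.
  have nab : b != a by apply: contraTneq ab => ->; rewrite sedge_irrefl.
  have allG : [set a; b] = setT.
    by apply/eqP; rewrite eqEcard subsetT cardsT cards2 eq_sym nab.
  have cov z : (z == a) || (z == b).
    by have := in_setT z; rewrite -allG !inE.
  exists [set a], (fun=> b); split.
    rewrite imset_set1; apply/setP => z; rewrite !inE.
    by have := cov z; have [->|] := eqVneq z a; rewrite ?(eq_sym a) ?(negPf nab).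
  move=> c /set1P -> z; have := cov z; have [->|_ /= /eqP ->] := eqVneq z a.
    by rewrite sedge_sym.
  by rewrite sedge_irrefl.
pose leaf (v u : G) := sedge u v && [forall z, sedge v z ==> (z == u)].
have leafP (v u : G) : leaf v u -> sedge u v /\ forall z, sedge v z -> z = u.
  by case/andP=> uv /forallP h; split=> // z vz; apply/eqP; exact: (implyP (h z)).
pose C := [set x : G | 1 < #|nbhd setT x|].
pose lf u := odflt u [pick v | leaf v u].
have lfP u : u \in C -> leaf (lf u) u.
  rewrite inE => /card_gt1P[w1 [w2 [h1 h2 n12]]]; rewrite !inE /= in h1 h2.
  have [v uv Nv] := pendant_exists acG wcG h1 h2 n12.
  rewrite /lf; case: pickP => //= /(_ v); rewrite /leaf uv /=.
  by move=> /negP[]; apply/forallP => z; apply/implyP => /Nv ->.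
have leafC v u : leaf v u -> v \notin C.
  move=> /leafP[_ Nv]; rewrite inE -leqNgt; apply/card_le1_eqP => x y.
  by rewrite !inE /= => /Nv -> /Nv ->.
have leaf_of x : x \notin C -> exists2 u, u \in C & leaf x u.
  rewrite inE -leqNgt => /card_le1_eqP Nx; have [u xu] := exN x.
  have Nxu z : sedge x z -> z = u by move=> xz; apply: Nx; rewrite !inE.
  have xleaf : leaf x u.
    by rewrite /leaf sedge_sym xu; apply/forallP => z; apply/implyP => /Nxu ->.
  (* If [u] had degree one as well, [x] and [u] would form a component and hence a whole graph of
     order two. *)
  exists u => //; rewrite inE ltnNge; apply/negP => /card_le1_eqP Nu.
  have Nux z : sedge u z -> z = x.
    by move=> uz; apply: Nu; rewrite !inE //= sedge_sym.
  have : #|[set x; u]| = #|G|.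
    rewrite -cardsT; congr #|pred_of_set _|; apply/setP => z; rewrite [RHS]inE.
    apply: (connect_invariant (P := mem [set x; u]) _ (conG x z)); last by rewrite !inE eqxx.
    by move=> a b ab /set2P[ax|au]; rewrite !inE; [rewrite (Nxu b) -?ax // eqxx orbT|
      rewrite (Nux b) -?au // eqxx].
  by rewrite cards2; case: (x != u); lia.
exists C, lf; split.
  apply/setP => x; rewrite in_setC; apply/imsetP/idP => [[c cC ->]|].
    exact: leafC (lfP c cC).
  move=> /leaf_of[u uC /leafP[ux Nx]]; exists u => //.
  have [ul Nl] := leafP _ _ (lfP u uC).
  exact: pendant_unique ux ul Nx Nl.
move=> c cC z; have [ul Nl] := leafP _ _ (lfP c cC).
by apply/idP/eqP => [/Nl|->]; rewrite // sedge_sym.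
Qed.

(** * Values of independence polynomials *)

Import Order.TTheory GRing.Theory Num.Theory.
Local Open Scope ring_scope.

Section PolynomialValues.
Variables (G : sgraph) (F : comNzRingType) (x : F).
Implicit Types (U W C : {set G}) (v : G).
Local Notation p U := (ipoly F U).[x].

Lemma ipoly_disjoint U W : [disjoint U & W] ->
  {in U & W, forall u w, ~~ sedge u w} -> p (U :|: W) = p U * p W.
Proof.
have [m] := ubnP #|U|; elim: m U => // m IH U leU dUW nUW.
have [->|/set0Pn[v vU]] := eqVneq U set0.
  by rewrite set0U ipoly_set0 hornerC mul1r.
have vW : v \notin W by rewrite (disjointFr dUW vU).
have IHs (V : {set G}) : V \subset U :\ v -> p (V :|: W) = p V * p W.
  move=> sV; have sVU : V \subset U by apply: subset_trans sV (subsetDl _ _).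
  apply: IH.
  - rewrite -ltnS (leq_trans _ leU) // ltnS (cardsD1 v U) vU ltnS.
    exact: subset_leq_card.
  - exact: disjointWl dUW.
  - by move=> a b aV bW; apply: nUW => //; apply: (subsetP sVU).
rewrite (ipolyE_rec x vU) (@ipolyE_rec _ _ (U :|: W) v) ?inE ?vU //.
have -> : (U :|: W) :\ v = (U :\ v) :|: W.
  rewrite setDUl; congr (_ :|: _); apply/setP => z; rewrite !inE.
  by case: eqP => // ->; rewrite (negPf vW).
have -> : delN (U :|: W) v = delN U v :|: W.
  apply/setP => z; rewrite !inE; have [zW|] := boolP (z \in W); last by rewrite !orbF.
  rewrite !orbT nUW // andbT; apply: contraNneq vW => <- //.
by rewrite !IHs ?delN_sub //; ring.
Qed.

Lemma ipoly_independent W : independent W -> p W = (1 + x) ^+ #|W|.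
Proof.
have [m] := ubnP #|W|; elim: m W => // m IH W leW iW.
have [->|/set0Pn[v vW]] := eqVneq W set0.
  by rewrite ipoly_set0 hornerC cards0 expr0.
have dE : delN W v = W :\ v.
  apply/setP => z; rewrite !inE; have [zW|] := boolP (z \in W); last by rewrite andbF.
  by rewrite (independentP _ iW) ?andbT.
rewrite (ipolyE_rec x vW) dE (cardsD1 v W) vW exprS IH; first by ring.
  by rewrite (cardsD1 v) vW in leW.
exact: independent_subset (subsetDl _ _) iW.
Qed.

Lemma ipoly_star u W : u \notin W -> independent W -> {in W, forall z, sedge u z} ->
  p (u |: W) = (1 + x) ^+ #|W| + x.
Proof.
move=> uW iW Nu; rewrite (@ipolyE_rec _ _ _ u) ?setU11 // setU1K //.
have -> : delN (u |: W) u = set0.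
  apply/setP => z; rewrite !inE; case: eqVneq => //= _.
  by apply/negP => /andP[/Nu ->].
by rewrite ipoly_set0 hornerC mulr1 ipoly_independent.
Qed.
End PolynomialValues.

(** [W] may exceed [U] because, in the recursion at [v], deleting [v] leaves its pendant vertex
    isolated with a factor [1 + x]. Choosing [v] removes that vertex, and the missing factor turns
    [x] into [x / (1 + x)]. *)
Lemma ipoly_pendant (G : sgraph) (F : fieldType) (C : {set G}) (lf : G -> G)
    (x : F) (U W : {set G}) :
  pendant_core C lf -> 1 + x != 0 -> U \subset W -> W \subset C ->
  (ipoly F (U :|: lf @: W)).[x] = (1 + x) ^+ #|W| * (ipoly F U).[x / (1 + x)].
Proof.
move=> core x1; have [lfC Nlf] := core.
have lfNC := pendant_notin core; have lfI := pendant_inj core.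
have [m] := ubnP #|U|; elim: m U W => // m IH U W leU UW WC.
have sWC : {subset W <= C} := subsetP WC.
have [->|/set0Pn[v vU]] := eqVneq U set0.
  rewrite set0U ipoly_set0 hornerC mulr1 -(card_in_imset (sub_in2 sWC lfI)).
  apply: ipoly_independent; apply/independentP => _ _ /imsetP[a aW ->] /imsetP[b bW ->].
  rewrite Nlf ?sWC //; apply: contraTneq (lfNC _ (sWC _ bW)) => ->.
  by rewrite negbK sWC.
have vW := subsetP UW _ vU; have vC := sWC _ vW.
rewrite (ipolyE_rec _ vU) (@ipolyE_rec _ _ (U :|: lf @: W) v) ?inE ?vU //.
have notlf (W' : {set G}) : W' \subset C -> v \notin lf @: W'.
  move=> W'C; apply/imsetP => -[w wW' vE]; move: (lfNC w (subsetP W'C _ wW')).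
  by rewrite -vE vC.
have -> : (U :|: lf @: W) :\ v = (U :\ v) :|: lf @: W.
  rewrite setDUl; congr (_ :|: _); apply/setP => z; rewrite in_setD1.
  by case: eqP => // ->; rewrite (negPf (notlf _ WC)).
have -> : delN (U :|: lf @: W) v = delN U v :|: lf @: (W :\ v).
  apply/setP => z; rewrite inE [z \in delN U v :|: _]inE [z \in delN U v]inE in_setU.
  have [/imsetP[w wW ->]|zlf] := boolP (z \in lf @: W).
    have -> : lf w \in U = false.
      by apply: contraNF (lfNC w (sWC _ wW)) => /(subsetP UW)/sWC.
    rewrite /= sedge_sym Nlf ?sWC //.
    have -> /= : lf w != v by apply: contraNneq (lfNC w (sWC _ wW)) => ->.
    apply/idP/imsetP => [vw|[w' w'W /lfI ww']].
      by exists w => //; rewrite !inE eq_sym vw.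
    by move: w'W; rewrite in_setD1 => /andP[w'v w'W]; rewrite ww' ?sWC // eq_sym.
  have -> : z \in lf @: (W :\ v) = false.
    by apply: contraNF zlf; apply/subsetP; apply: imsetS; exact: subsetDl.
  by rewrite !orbF.
have lt : (#|U :\ v| < m)%N by move: leU; rewrite (cardsD1 v U) vU.
rewrite IH //; last exact: subset_trans (subsetDl _ _) UW.
rewrite IH; first last.
- exact: subset_trans (subsetDl _ _) WC.
- exact: subset_trans (delN_sub _ _) (setSD _ UW).
- exact: leq_ltn_trans (subset_leq_card (delN_sub _ _)) lt.
rewrite (cardsD1 v W) vW exprS.
by field.
Qed.

(** * Independence polynomials of paths *)

Section PathPolynomial.
Variables (F : comNzRingType) (x : F).

(* The value at [x] of the independence polynomial of the path of order
   [n - 2], with the recurrence continued down to [n = 0]. *)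
Fixpoint path_val (n : nat) : F :=
  if n is n'.+1 then
    if n' is n''.+1 then path_val n' + x * path_val n'' else 1
  else 0.

Lemma path_valSS n : path_val n.+2 = path_val n.+1 + x * path_val n.
Proof. by []. Qed.

(** For positive [p] and [q] this is the deletion recurrence at the [p]-th vertex of the path of
    order [p + q - 1]. *)
Lemma path_val_add p q : path_val (p + q).+1 =
  path_val p.+1 * path_val q.+1 + x * path_val p * path_val q.
Proof.
elim/ltn_ind: p => -[|[|p]] IH; first by rewrite add0n /=; ring.
  by rewrite add1n path_valSS /=; ring.
rewrite 2!addSn path_valSS -addSn IH // (IH p) // (path_valSS p.+1) (path_valSS p).
ring.
Qed.

Variable G : sgraph.

(** Quantifying over all pairs of positions also excludes chords, and matches [path_edge]. *)
Definition induced_path (l : seq G) : Prop :=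
  uniq l /\ forall x0 i j, (i < size l)%N -> (j < size l)%N ->
    sedge (nth x0 l i) (nth x0 l j) = (i.+1 == j) || (j.+1 == i).

Lemma induced_path_behead v l : induced_path (v :: l) -> induced_path l.
Proof.
move=> [/= /andP[_ ul] h]; split=> // x0 i j li lj.
by have := h x0 i.+1 j.+1 li lj; rewrite /= !eqSS.
Qed.

Lemma ipoly_induced_path l : induced_path l ->
  (ipoly F [set z in l]).[x] = path_val (size l).+2.
Proof.
have [m] := ubnP (size l); elim: m l => // m IH [|v l] /= lel hl.
  by rewrite set_nil ipoly_set0 hornerC /= mulr0 addr0.
have [/= /andP[vl ul] h] := hl.
have vU : v \in [set z in v :: l] by rewrite !inE eqxx.
rewrite (ipolyE_rec x vU).
have -> : [set z in v :: l] :\ v = [set z in l].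
  by apply/setP => z; rewrite !inE; have [->|] := eqVneq z v; rewrite ?(negPf vl).
have -> : delN [set z in v :: l] v = [set z in behead l].
  apply/setP => z; rewrite !inE.
  case: l vl ul h {hl vU lel} => [|w l] /= vl ul h.
    by rewrite orbF; case: eqP.
  rewrite inE; have vw : sedge v w by rewrite (h v 0 1)%N.
  have [->|zv] /= := eqVneq z v.
    by move: vl; rewrite inE negb_or => /andP[_ /negPf ->].
  have [->|zw] /= := eqVneq z w.
    by rewrite vw; move/andP: ul => [/negPf ->].
  have [zl|//] := boolP (z \in l).
  have := h v 0%N (index z l).+2; rewrite /= nth_index // => -> //.
  by rewrite !ltnS index_mem.
rewrite IH //; last exact: induced_path_behead hl.
case: l lel hl {vl ul h vU} => [|w l] /= lel hl.
  by rewrite set_nil ipoly_set0 hornerC /=; ring.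
rewrite IH //; first by rewrite ltnW.
exact/induced_path_behead/induced_path_behead/hl.
Qed.

(** Reversing the first list makes [r] and [s], the ends of the only connecting edge,
    consecutive. *)
Lemma induced_path_cat r l1 s l2 :
  induced_path (r :: l1) -> induced_path (s :: l2) -> sedge r s ->
  {in r :: l1, forall y, y \notin s :: l2} ->
  {in r :: l1 & s :: l2, forall y z, sedge y z -> y = r /\ z = s} ->
  induced_path (rev (r :: l1) ++ (s :: l2)).
Proof.
move=> [u1 h1] [u2 h2] rs dis cross.
move: (erefl (r :: l1)) (erefl (s :: l2)).
move: {2 3}(r :: l1) {2 3}(s :: l2) => m1 m2 E1 E2.
rewrite E1 E2 in u1 h1 u2 h2 dis cross *.
split.
  rewrite cat_uniq rev_uniq u1 u2 andbT /=; apply/hasPn => z z2.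
  by rewrite mem_rev; apply/negP => /dis; rewrite z2.
have mix x0 i j : (i < size m1)%N -> (j < size m2)%N ->
    sedge (nth x0 m1 i) (nth x0 m2 j) = (i == 0)%N && (j == 0)%N.
  have [s1 s2] : (0 < size m1)%N /\ (0 < size m2)%N by rewrite -E1 -E2.
  have [n1 n2] : nth x0 m1 0 = r /\ nth x0 m2 0 = s by rewrite -E1 -E2.
  move=> li lj; apply/idP/andP => [/cross|[/eqP -> /eqP ->]]; last by rewrite n1 n2.
  rewrite !mem_nth // -n1 -n2 => /(_ isT isT)[/eqP + /eqP].
  by rewrite !nth_uniq.
move=> x0 i j; rewrite size_cat size_rev => li lj.
rewrite !nth_cat !size_rev.
case: ltnP => i1; case: ltnP => j1.
- rewrite !nth_rev // h1; [|lia|lia].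
  lia.
- rewrite nth_rev // mix; [|lia|lia].
  lia.
- rewrite sedge_sym nth_rev // mix; [|lia|lia].
  lia.
- rewrite h2; [|lia|lia].
  lia.
Qed.
End PathPolynomial.

(** * Comparison with the path *)

(** In [tree_le_path] the positive value of such a subtree bounds the value of the path of order [j]
    from below. The subtree fills [U] first and then takes the rest from [W]. *)
Lemma rooted_tree_subtree (G : sgraph) (U : {set G}) r j :
  rooted_tree U r -> (0 < j <= #|U|)%N ->
  exists W : {set G}, [/\ W \subset U, rooted_tree W r & #|W| = j].
Proof.
move=> tU; elim: tU j => [{}r|{}U W {}r s tU IHU tW IHW dUW rs cross] j.
  rewrite cards1 => j1; exists [set r]; split => //; first exact: rooted_tree1.
  by rewrite cards1; lia.
have := leq_card_setU U W; rewrite /leqif dUW => -[_ /eqP ->].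
have [jU|Uj] := leqP j #|U| => /andP[j0 jUW].
  have [|V [VU tV cV]] := IHU j; first by rewrite j0.
  by exists V; split => //; apply: subset_trans VU (subsetUl _ _).
have [|V [VW tV cV]] := IHW (j - #|U|)%N; first by lia.
exists (U :|: V); split; first exact: setUS.
  apply: rooted_tree_join tU tV _ rs _; first exact: disjointWr dUW.
  by move=> x y xU /(subsetP VW); apply: cross.
have dUV : [disjoint U & V] by apply: disjointWr dUW.
by have := leq_card_setU U V; rewrite /leqif dUV => -[_ /eqP ->]; lia.
Qed.

Section PathBound.
Variable R : realFieldType.
Implicit Types a b c d t : R.

Lemma mulr_eq_le a b c d : 0 < a <= c -> 0 < b <= d -> a * b = c * d ->
  a = c /\ b = d.
Proof.
move=> /andP[a0 ac] /andP[b0 bd] e.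
have h1 : (c - a) * d = 0 by apply/eqP; rewrite eq_le; apply/andP; split; nra.
have h2 : c * (d - b) = 0 by apply/eqP; rewrite eq_le; apply/andP; split; nra.
move/eqP: h1; rewrite mulf_eq0 => /orP[] /eqP; last by lra.
move/eqP: h2; rewrite mulf_eq0 => /orP[] /eqP; first by lra.
by move=> *; split; lra.
Qed.

(* Two rooted trees with values [I1, I2] and values [B1, B2] after deletion of
   the closed neighbourhood of the root are joined by an edge between their
   roots; the [a]'s and [p]'s are the corresponding values for paths rooted at
   an end. *)
Lemma join_bound t I1 I2 B1 B2 a1 a2 p1 p2 d :
  let I := I1 * I2 - t ^+ 2 * B1 * B2 in
  let S := a1 * a2 - t ^+ 2 * p1 * p2 in
  let B := B1 * (I2 + t * B2) in
  let P := p1 * (a2 + t * p2) - t * d * p2 in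
  0 < t -> 0 < I1 -> 0 < I2 -> 0 < I -> 0 < p1 -> 0 < p2 -> 0 <= d ->
  I1 <= a1 -> I2 <= a2 -> p1 * I1 <= a1 * B1 -> p2 * I2 <= a2 * B2 ->
  [/\ I <= S, P * I <= S * B,
      I = S -> [/\ I1 = a1, I2 = a2, p1 * I1 = a1 * B1 & p2 * I2 = a2 * B2] &
      I = S -> P * I = S * B -> d = 0].
Proof.
move=> I S B P t0 I10 I20 I0 p10 p20 d0 h1 h2 k1 k2.
have a10 : 0 < a1 by apply: lt_le_trans h1.
have a20 : 0 < a2 by apply: lt_le_trans h2.
have I12 : 0 < I1 * I2 by apply: mulr_gt0.
have a12 : I1 * I2 <= a1 * a2 by apply: ler_pM => //; apply: ltW.
have q1 : 0 < p1 * I1 by apply: mulr_gt0.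
have q2 : 0 < p2 * I2 by apply: mulr_gt0.
have kk : (p1 * I1) * (p2 * I2) <= (a1 * B1) * (a2 * B2).
  by apply: ler_pM => //; apply: ltW.
have t2 : 0 < t ^+ 2 by apply: exprn_gt0.
(* With denominators cleared, this compares [1 - l1 * l2] for the trees and for the paths, where
   [l = t * B / I] is smaller for paths. *)
have SI : a1 * a2 * I <= S * (I1 * I2).
  have := ler_wpM2l (ltW t2) kk; rewrite /S /I; lra.
have aI : I1 * I2 * I <= a1 * a2 * I by rewrite ler_pM2r.
have IS : I <= S.
  by rewrite -(ler_pM2r I12) (le_trans _ SI) // mulrC.
(* [p1 * (a2 + t * p2)] is the value for joined paths rooted at the joint; subtracting [t * d * p2]
   moves the root to an end. The bound holds before this subtraction, so equality for [P] forces
   [d = 0]. *)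
have PS' : p1 * (a2 + t * p2) * I <= S * B.
  rewrite -(ler_pM2r I12).
  have e1 : p1 * (a2 + t * p2) * I * (I1 * I2) =
      I * ((p1 * I1) * (a2 * I2 + t * (p2 * I2))) by ring.
  have e2 : S * B * (I1 * I2) = S * (I1 * I2) * B by ring.
  have B10 : 0 < B1 by rewrite -(pmulr_rgt0 _ a10) (lt_le_trans q1).
  have B20 : 0 < B2 by rewrite -(pmulr_rgt0 _ a20) (lt_le_trans q2).
  have B0 : 0 <= B.
    by rewrite /B mulr_ge0 ?ltW // addr_gt0 // mulr_gt0.
  rewrite e1 e2; apply: le_trans (ler_wpM2r B0 SI).
  have -> : a1 * a2 * I * B = I * ((a1 * B1) * (a2 * I2 + t * (a2 * B2))).
    by rewrite /B; ring.
  rewrite ler_pM2l //; apply: ler_pM => //; first exact: ltW.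
    by rewrite addr_ge0 // ?mulr_ge0 // ltW.
  by rewrite lerD2l ler_pM2l.
have dp : 0 <= t * d * p2 * I by rewrite !mulr_ge0 // ltW.
split=> //.
- by apply: le_trans PS'; rewrite /P mulrBl; lra.
- move=> eIS; rewrite -eIS in SI.
  have eI : I1 * I2 = a1 * a2.
    have In0 : I != 0 by rewrite gt_eqF.
    by apply: (mulIf In0); apply: le_anti; rewrite aI (mulrC (I1 * I2)) SI.
  have [e1 e2] : I1 = a1 /\ I2 = a2.
    by apply: mulr_eq_le eI; apply/andP.
  have ek : (p1 * I1) * (p2 * I2) = (a1 * B1) * (a2 * B2).
    have t2' : t ^+ 2 != 0 by rewrite gt_eqF.
    apply: (mulfI t2'); rewrite -e1 -e2.
    move: eIS; rewrite /I /S -e1 -e2 => eIS.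
    transitivity (I1 * I2 * (t ^+ 2 * p1 * p2)); first by ring.
    transitivity (I1 * I2 * (t ^+ 2 * B1 * B2)); last by ring.
    by congr (_ * _); lra.
  have [] := mulr_eq_le (a := p1 * I1) (c := a1 * B1) (b := p2 * I2) (d := a2 * B2) _ _ ek.
  + by apply/andP.
  + by apply/andP.
  + by [].
- move=> eIS ePB; have dp0 : t * d * p2 * I = 0.
    apply: le_anti; rewrite dp andbT; move: ePB PS'; rewrite /P mulrBl; lra.
  move/eqP: dp0; rewrite !mulf_eq0 (gt_eqF t0) (gt_eqF p20) (gt_eqF I0) !orbF.
  by move=> /= /eqP.
Qed.
End PathBound.

Section TreePath.
Variables (R : realType) (G : sgraph) (x : R).
Hypothesis x0 : x < 0.
Implicit Types (U W : {set G}) (r s : G).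
Local Notation p U := (ipoly R U).[x].
Local Notation b := (path_val x).

(** Without the edge [r s] the value would be a product; the subtracted term accounts for the sets
    containing both ends. Deleting the closed neighbourhood of [r] removes only [s] from [W]. *)
Lemma ipoly_join U W r s : r \in U -> s \in W -> [disjoint U & W] ->
  sedge r s -> {in U & W, forall x y, sedge x y -> x = r /\ y = s} ->
  p (U :|: W) = p U * p W - x ^+ 2 * p (delN U r) * p (delN W s) /\
  p (delN (U :|: W) r) = p (delN U r) * (p W - x * p (delN W s)).
Proof.
move=> rU sW dUW rs cross.
have rW : r \notin W by rewrite (disjointFr dUW rU).
have -> : p W - x * p (delN W s) = p (W :\ s) by rewrite (ipolyE_rec x sW) addrK.
have dE : delN (U :|: W) r = delN U r :|: (W :\ s).
  apply/setP => z; rewrite !inE.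
  have [zW|] := boolP (z \in W); last by rewrite andbF !orbF.
  rewrite (disjointFl dUW zW) /= ?andbT.
  have -> /= : z != r by apply: contraNneq rW => <-.
  by congr (~~ _); apply/idP/eqP => [/(cross _ _ rU zW)[]//|->].
have dis (V : {set G}) : V \subset U -> [disjoint V & W].
  by move=> VU; exact: disjointWl VU dUW.
have dN : p (delN (U :|: W) r) = p (delN U r) * p (W :\ s).
  have sU : delN U r \subset U by apply: subset_trans (delN_sub _ _) (subsetDl _ _).
  rewrite dE ipoly_disjoint //.
    by apply: disjointWr (subsetDl _ _) _; exact: dis.
  move=> u w uD; rewrite !inE => /andP[ws wW]; apply/negP => uw.
  by have [_ ws'] := cross _ _ (subsetP sU _ uD) wW uw; rewrite ws' eqxx in ws.
split=> //; rewrite (@ipolyE_rec _ _ (U :|: W) r) ?inE ?rU // dN.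
have -> : (U :|: W) :\ r = (U :\ r) :|: W.
  rewrite setDUl; congr (_ :|: _); apply/setP => z; rewrite in_setD1.
  by case: eqP => // ->; rewrite (negPf rW).
rewrite ipoly_disjoint; first last.
- move=> u w; rewrite !inE => /andP[ur uU] wW; apply/negP => uw.
  by have [ur' _] := cross _ _ uU wW uw; rewrite ur' eqxx in ur.
- exact/dis/subsetDl.
rewrite (ipolyE_rec x rU) (ipolyE_rec x sW); ring.
Qed.

(** At a join, the first bound relies on the second one for the parts. Equality in the first forces
    both equalities for the parts, so they are paths rooted at ends and concatenate along [r s].
    Equality in the second as well forces [U] to be the single vertex [r], which is then an end. *)
Lemma tree_le_path U r : rooted_tree U r ->
  (forall W, W \subset U -> 0 < p W) ->
  [/\ p U <= b #|U|.+2, b #|U| * p U <= b #|U|.+2 * p (delN U r),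
      p U = b #|U|.+2 -> exists2 l, induced_path l & U = [set z in l] &
      p U = b #|U|.+2 -> b #|U| * p U = b #|U|.+2 * p (delN U r) ->
        exists2 l, induced_path (r :: l) & U = [set z in r :: l]].
Proof.
have [m] := ubnP #|U|; elim: m U r => // m IH U r leU tU pos.
(* Index [j] stands for order [j - 2], below [#|U|], so from [j = 3] on the induction hypothesis
   applies to a subtree of that order. *)
have bpos j : (0 < j <= #|U|.+1)%N -> 0 < b j.
  case: j => [|[|j]] // jU.
  case: j jU => [|j] jU; first by rewrite /= mulr0 addr0 ltr01.
  have [|W [WU tW cW]] := rooted_tree_subtree (j := j.+1) tU; first by lia.
  have [|V VW|h _ _ _] := IH W r _ tW.
  - by rewrite cW; lia.
  - by apply: pos; apply: subset_trans WU.
  - by rewrite -cW; apply: lt_le_trans h; apply: pos.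
have t0 : 0 < - x by rewrite oppr_gt0.
case: tU leU pos bpos => [{}r leU pos _|{}U W {}r s tU tW dUW rs cross leUW pos bpos].
  have dr : delN [set r] r = set0.
    by apply/setP => z; rewrite !inE; case: eqP.
  have h : induced_path [:: r].
    by split=> // x1 [|i] [|j] //= _ _; rewrite sedge_irrefl.
  have p1 : p [set r] = 1 + x.
    by rewrite (@ipolyE_rec _ _ _ r) ?set11 // setDv dr !ipoly_set0 !hornerC mulr1.
  have sE : [set r] = [set z in [:: r]] by apply/setP => z; rewrite !inE.
  rewrite dr cards1 ipoly_set0 hornerC p1 /=; split; try lra.
  - by move=> _; exists [:: r].
  - by move=> _ _; exists [::].
have rU := rooted_tree_root tU; have sW := rooted_tree_root tW.
have cUW : #|U :|: W| = (#|U| + #|W|)%N.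
  by have := leq_card_setU U W; rewrite /leqif dUW => -[_ /eqP].
have U0 : (0 < #|U|)%N by apply/card_gt0P; exists r.
have W0 : (0 < #|W|)%N by apply/card_gt0P; exists s.
rewrite cUW in leUW bpos *.
have posU (V : {set G}) : V \subset U -> 0 < p V.
  by move=> VU; apply: pos; apply: subset_trans VU (subsetUl _ _).
have posW (V : {set G}) : V \subset W -> 0 < p V.
  by move=> VW; apply: pos; apply: subset_trans VW (subsetUr _ _).
have [|U1 U2 U3 U4] := IH U r _ tU posU; first by move: leUW W0; clear; lia.
have [|W1 W2 W3 W4] := IH W s _ tW posW; first by move: leUW U0; clear; lia.
have [pE dE] := ipoly_join rU sW dUW rs cross.
have posUW := pos _ (subxx _).
case nU : #|U| U0 => [//|n] _.
(* [b n] is the [d] of [join_bound]; it vanishes only for [n = 0], when [U] is a single vertex. *)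
have d0 : 0 <= b n.
  case: n nU => [|n] nU; first by rewrite /= lexx.
  by apply/ltW/bpos; rewrite nU; clear; lia.
(* Cutting the long path into paths of orders [n.+1] and [#|W|] gives the shape of [ipoly_join]. *)
have bS : b (n.+1 + #|W|).+2 =
    b n.+3 * b #|W|.+2 - (- x) ^+ 2 * b n.+1 * b #|W|.
  have -> : (n.+1 + #|W|).+2 = (n.+2 + #|W|).+1 by rewrite !addSn.
  by rewrite path_val_add (path_valSS x n.+1) (path_valSS x #|W|); ring.
have bP : b (n.+1 + #|W|)%N =
    b n.+1 * (b #|W|.+2 + - x * b #|W|) - - x * b n * b #|W|.
  by rewrite addSn path_val_add (path_valSS x #|W|); ring.
rewrite nU in U1 U2 U3 U4 bpos *.
have := @join_bound R (- x) (p U) (p W) (p (delN U r)) (p (delN W s))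
  (b n.+3) (b #|W|.+2) (b n.+1) (b #|W|) (b n).
rewrite -bS -bP !sqrrN !mulNr -pE -dE.
case.
- exact: t0.
- exact: posU.
- exact: posW.
- exact: posUW.
- by apply: bpos; clear; lia.
- by apply: bpos; move: W0; clear; lia.
- exact: d0.
- exact: U1.
- exact: W1.
- exact: U2.
- exact: W2.
move=> J1 J2 J3 J4.
have concat : p (U :|: W) = b (n.+1 + #|W|).+2 -> exists l1 l2,
    [/\ induced_path (rev (r :: l1) ++ s :: l2), U = [set z in r :: l1] &
        W = [set z in s :: l2]].
  move=> e; have [eU eW kU kW] := J3 e.
  have [l1 p1 UE] := U4 eU kU; have [l2 p2 WE] := W4 eW kW.
  have inU z : (z \in r :: l1) = (z \in U) by rewrite UE in_set.
  have inW z : (z \in s :: l2) = (z \in W) by rewrite WE in_set.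
  exists l1, l2; split=> //; apply: induced_path_cat => //.
    by move=> z; rewrite inU inW => zU; rewrite (disjointFr dUW zU).
  by move=> y z; rewrite inU inW; apply: cross.
split=> //.
- move=> /concat[l1 [l2 [hl UE WE]]]; exists (rev (r :: l1) ++ s :: l2) => //.
  by apply/setP => z; rewrite {1}UE {1}WE in_set mem_cat mem_rev !in_set.
- move=> e k; have [l1 [l2 [hl UE WE]]] := concat e.
  have bn0 := J4 e k.
  have l10 : l1 = [::].
    have n0 : n = 0%N.
      apply/eqP; rewrite -leqn0 leqNgt; apply/negP => n0.
      have : 0 < b n by apply: bpos; move: n0; clear; lia.
      by rewrite bn0 ltxx.
    have u1 : uniq (r :: l1).
      by move: hl.1; rewrite cat_uniq rev_uniq => /and3P[].
    have : #|U| = size (r :: l1) by rewrite UE cardsE (card_uniqP u1).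
    by rewrite nU n0 => -[/esym/size0nil].
  exists (s :: l2); first by rewrite l10 in hl.
  by apply/setP => z; rewrite {1}UE {1}WE l10 !inE ?orbF.
Qed.
End TreePath.

(** * Comparison with the star *)

Section TreeStar.
Variables (R : realType) (G : sgraph) (x : R).
Hypotheses (x0 : x < 0) (x1 : 0 < 1 + x).
Implicit Types (U W : {set G}) (u v : G).
Local Notation p U := (ipoly R U).[x].

(** By [ipoly_anti] the value on [delN U v] is at least that on [U :\ v]; since [x < 0], adding [v]
    contributes at most a factor [1 + x]. *)
Lemma ipoly_le_independent U : (forall W, W \subset U -> 0 <= p W) ->
  p U <= (1 + x) ^+ #|U|.
Proof.
have [m] := ubnP #|U|; elim: m U => // m IH U leU pos.
have [->|/set0Pn[v vU]] := eqVneq U set0.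
  by rewrite ipoly_set0 hornerC cards0 expr0.
have UvU : U :\ v \subset U := subsetDl _ _.
have posv (W : {set G}) : W \subset U :\ v -> 0 <= p W.
  by move=> WU; apply: pos; apply: subset_trans UvU.
have leU' : (#|U :\ v| < m)%N by move: leU; rewrite (cardsD1 v U) vU.
have h1 := ipoly_anti (ltW x0) posv (delN_sub U v).
have h2 := ler_wpM2l (ltW x1) (IH _ leU' posv).
have h3 := ler_wnM2l (ltW x0) h1.
rewrite (ipolyE_rec x vU) (cardsD1 v U) vU exprS; lra.
Qed.

(** An edge [u v] bounds the value by [(1 + 2x) p(W)], with [W] the set [U] without [u] and [v]. If
    [1 + 2x >= 0], this is short of [(1 + x)^2 (1 + x)^#|W|] by at least [x^2 (1 + x)^#|W|];
    otherwise it is not positive. *)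
Lemma ipoly_eq_independent U : (forall W, W \subset U -> 0 <= p W) ->
  p U = (1 + x) ^+ #|U| -> independent U.
Proof.
move=> pos e; apply/independentP => u v uU vU; apply/negP => uv.
have nuv : u != v by apply: contraTneq uv => ->; rewrite sedge_irrefl.
have uUv : u \in U :\ v by rewrite !inE nuv.
pose W := U :\ v :\ u.
have WU : W \subset U by apply: subset_trans (subsetDl _ _) (subsetDl _ _).
have posW (V : {set G}) : V \subset W -> 0 <= p V.
  by move=> VW; apply: pos; apply: subset_trans WU.
have N1 : delN (U :\ v) u \subset W by exact: delN_sub.
have N2 : delN U v \subset W.
  apply/subsetP => z; rewrite !inE => /and3P[-> -> vz]; rewrite !andbT.
  by apply: contraNneq vz => ->; rewrite sedge_sym.
have h1 := ler_wnM2l (ltW x0) (ipoly_anti (ltW x0) posW N1).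
have h2 := ler_wnM2l (ltW x0) (ipoly_anti (ltW x0) posW N2).
have h3 := ipoly_le_independent posW.
have h4 := posW _ (subxx _).
have E0 : 0 < (1 + x) ^+ #|W| by apply: exprn_gt0.
move: e; rewrite (ipolyE_rec x vU) (ipolyE_rec x uUv) -/W.
rewrite (cardsD1 v U) vU (cardsD1 u (U :\ v)) uUv -/W !add1n !exprS => e.
have x20 : 0 < x ^+ 2 * (1 + x) ^+ #|W| by rewrite mulr_gt0 // exprn_even_gt0 //= lt_eqF.
have [x2|x2] := leP 0 (1 + 2 * x).
  have := ler_wpM2l x2 h3; lra.
have := mulr_le0_ge0 (ltW x2) h4.
have : 0 < (1 + x) * ((1 + x) * (1 + x) ^+ #|W|) by rewrite !mulr_gt0.
lra.
Qed.

Lemma delN_leaf U v : (#|nbhd U v| <= 1)%N -> forall u, u \in nbhd U v ->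
  delN U v = U :\ v :\ u.
Proof.
move=> /card_le1_eqP Nv u uN; apply/setP => z; rewrite !inE.
have [zU|] := boolP (z \in U); last by rewrite !andbF.
rewrite /= andbT andbC; congr (~~ _ && _); apply/idP/eqP => [vz|->].
  by apply: Nv; rewrite // inE zU.
by move: uN; rewrite inE => /andP[].
Qed.

(** Only the star of order [n] is assumed nonnegative, so nonnegativity of forests is proved along
    with the bound. Removing a leaf and its neighbour calls for [ipoly_le_independent] on the rest,
    hence for nonnegativity on smaller sets. *)
Lemma forest_ge_star n U : acyclic G -> 0 <= (1 + x) ^+ n.-1 + x ->
  (0 < #|U| <= n)%N ->
  (1 + x) ^+ #|U|.-1 + x <= p U /\ (forall W, W \subset U -> 0 <= p W).
Proof.
move=> acG pn; have [m] := ubnP #|U|; elim: m U => // m IH U leU /andP[U0 Un].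
have key : (1 + x) ^+ #|U|.-1 + x <= p U.
  have posU (W : {set G}) : W \proper U -> 0 <= p W.
    move=> /proper_card WU; have [->|W0] := eqVneq W set0.
      by rewrite ipoly_set0 hornerC ler01.
    have [||_] := IH W; last exact.
      exact: leq_trans WU _.
    by rewrite card_gt0 W0 (leq_trans (ltnW WU)).
  have [v vU dv] : exists2 v, v \in U & (#|nbhd U v| <= 1)%N.
    by apply: forest_degree_le1 => //; rewrite -card_gt0.
  have cU : #|U| = #|U :\ v|.+1 by rewrite (cardsD1 v U) vU.
  have [U1|U1] := eqVneq (U :\ v) set0.
    have dN : delN U v = set0 by apply/eqP; rewrite -subset0 -U1 delN_sub.
    by rewrite (ipolyE_rec x vU) cU U1 dN cards0 ipoly_set0 hornerC expr0 mulr1.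
  have U10 : (0 < #|U :\ v|)%N by rewrite card_gt0.
  have [||IHv posv] := IH (U :\ v); [by rewrite -cU| by rewrite U10 ltnW // -cU|].
  have [u uN|noN] := pickP [in nbhd U v].
    have uUv : u \in U :\ v.
      move: uN; rewrite !inE => /andP[-> vu]; rewrite andbT.
      by apply: contraTneq vu => ->; rewrite sedge_irrefl.
    rewrite (ipolyE_rec x vU) (delN_leaf dv uN).
    have cUv : #|U :\ v| = #|U :\ v :\ u|.+1 by rewrite (cardsD1 u (U :\ v)) uUv.
    have h : p (U :\ v :\ u) <= (1 + x) ^+ #|U :\ v :\ u|.
      apply: ipoly_le_independent => W sW; apply: posv.
      exact: subset_trans sW (subsetDl _ _).
    move: IHv; rewrite cU cUv /= exprS => IHv.
    have := ler_wnM2l (ltW x0) h; lra.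
  have dN : delN U v = U :\ v.
    apply/setP => z; have := noN z; rewrite !inE => /=.
    by case: (z \in U); rewrite ?andbF //= ?andbT => ->; rewrite andbT.
  (* An isolated [v] multiplies the value by [1 + x], and [(1 + x) x >= x]. *)
  rewrite (ipolyE_rec x vU) dN cU.
  have -> : p (U :\ v) + x * p (U :\ v) = (1 + x) * p (U :\ v) by ring.
  have := ler_wpM2l (ltW x1) IHv.
  have -> : (1 + x) ^+ #|U :\ v|.+1.-1 = (1 + x) * (1 + x) ^+ #|U :\ v|.-1.
    by rewrite -exprS prednK.
  have := sqr_ge0 x; rewrite expr2; lra.
split=> // W WU; have [->|nWU] := eqVneq W U; last first.
  have [->|W0] := eqVneq W set0; first by rewrite ipoly_set0 hornerC ler01.
  have WpU : (#|W| < #|U|)%N by apply: proper_card; rewrite properEneq nWU.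
  have [||_ posW] := IH W.
  - exact: leq_trans WpU _.
  - by rewrite card_gt0 W0 (leq_trans (ltnW WpU)).
  - exact: posW.
(* Star values decrease with the order, so the one of order [n] is the least in question. *)
apply: le_trans key; apply: le_trans pn _; rewrite lerD2r.
by apply: ler_wiXn2l; [exact: ltW|rewrite gerDl ltW|move: Un; clear; lia].
Qed.

(** Equality in the leaf step of [forest_ge_star] makes the vertices other than the leaf [v] and its
    neighbour [u] independent. Since each of them has a neighbour, it must be [u]. *)
Lemma tree_eq_star U : acyclic G -> (1 < #|U|)%N ->
  {in U, forall z, exists2 w, w \in U & sedge z w} ->
  0 <= (1 + x) ^+ #|U|.-1 + x -> p U = (1 + x) ^+ #|U|.-1 + x ->
  exists u, [/\ u \in U, independent (U :\ u) & {in U :\ u, forall z, sedge u z}].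
Proof.
move=> acG U1 NU pU e.
have [v vU dv] : exists2 v, v \in U & (#|nbhd U v| <= 1)%N.
  by apply: forest_degree_le1 => //; rewrite -card_gt0 ltnW.
have [u uU vu] := NU v vU.
have uN : u \in nbhd U v by rewrite inE uU.
have nuv : u != v by apply: contraTneq vu => ->; rewrite sedge_irrefl.
have uUv : u \in U :\ v by rewrite !inE nuv.
have Nv z : z \in U -> sedge v z -> z = u.
  by move=> zU vz; move/card_le1_eqP: dv; apply; rewrite inE ?zU ?uU.
have cU : #|U| = #|U :\ v|.+1 by rewrite (cardsD1 v U) vU.
have cUv : #|U :\ v| = #|U :\ v :\ u|.+1 by rewrite (cardsD1 u (U :\ v)) uUv.
have [] := forest_ge_star (n := #|U|) (U := U) acG pU; first by rewrite (ltnW U1) /=.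
move=> _ pos.
have [] := forest_ge_star (n := #|U|) (U := U :\ v) acG pU.
  by rewrite cU leqnSn cUv.
move=> h _.
have posW (W : {set G}) : W \subset U :\ v :\ u -> 0 <= p W.
  by move=> sW; apply: pos; apply: subset_trans sW _;
    apply: subset_trans (subsetDl _ _) (subsetDl _ _).
have iW : independent (U :\ v :\ u).
  apply: ipoly_eq_independent => //; apply: le_anti.
  rewrite ipoly_le_independent //=.
  move: e h; rewrite (ipolyE_rec x vU) (delN_leaf dv uN) cU cUv /= exprS => e h.
  by rewrite -(ler_nM2l x0); lra.
have Nu : {in U :\ u, forall z, sedge u z}.
  move=> z; rewrite !inE => /andP[zu zU].
  have [->|zv] := eqVneq z v; first by rewrite sedge_sym.
  have [w wU zw] := NU z zU.
  have [<-|wu] := eqVneq w u; first by rewrite sedge_sym.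
  have [wv|wv] := eqVneq w v.
    by move: zw; rewrite wv sedge_sym => /(Nv _ zU) zu'; rewrite zu' eqxx in zu.
  have := independentP _ iW z w; rewrite !inE zu zv zU wu wv wU zw.
  by move=> /(_ isT isT).
exists u; split=> //; apply/independentP => a c aU cU'.
have vN z : z \in U :\ u -> ~~ sedge v z.
  by rewrite !inE => /andP[zu zU]; apply: contraNN zu => /(Nv _ zU) ->.
have [->|av] := eqVneq a v; first exact: vN.
have [->|cv] := eqVneq c v; first by rewrite sedge_sym vN.
move: aU cU'; rewrite !in_setD1 => /andP[au aU] /andP[cu cU'].
by apply: (independentP _ iW); rewrite !in_setD1 ?au ?av ?aU ?cu ?cv ?cU'.
Qed.
End TreeStar.

(** * The range of comparison and graph stars *)

Lemma poly_le_closed (R : realType) (p q : {poly R}) (a c : R) : a < c ->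
  (forall x, a < x < c -> p.[x] <= q.[x]) ->
  forall x, a <= x <= c -> p.[x] <= q.[x].
Proof.
move=> ac h x /andP[ax xc]; rewrite leNgt; apply/negP => qp.
have e0 : 0 < (p - q).[x] by rewrite hornerD hornerN subr_gt0.
have [d d0 near_x] : exists2 d : R, 0 < d &
    forall y, `|y - x| < d -> `|(p - q).[y] - (p - q).[x]| < (p - q).[x].
  exact: poly_cont.
have half (k : R) : 0 < k -> exists e, [/\ 0 < e, e < d & e < k].
  move=> k0; exists (Num.min d k / 2).
  have : 0 < Num.min d k by rewrite lt_min d0.
  have : Num.min d k <= d by rewrite ge_min lexx.
  have : Num.min d k <= k by rewrite ge_min lexx orbT.
  by move=> *; split; lra.
(* [y] moves from [x] into the open interval, to the right unless [x = c]; the violation persists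
   there by continuity. *)
have [y ayc yx] : exists2 y, a < y < c & `|y - x| < d.
  have [xlt|xge] := ltP x c.
    have [|e [epos ed ec]] := half (c - x); first by lra.
    exists (x + e); first by apply/andP; split; lra.
    by rewrite addrC addKr gtr0_norm.
  have [|e [epos ed ec]] := half (c - a); first by lra.
  exists (x - e); first by apply/andP; split; lra.
  by rewrite addrC addKr normrN gtr0_norm.
have := near_x y yx; have := h y ayc.
by rewrite !hornerD !hornerN distrC ltr_norml => *; lra.
Qed.

Lemma ipoly_gt_xi (R : realType) (G : sgraph) (x : R) : (0 < #|G|)%N ->
  xi R G < x -> forall U : {set G}, 0 < (ipoly R U).[x].
Proof.
move=> G0 xx; have [x0 [_ _ px0 pos]] := good_root R G0.
have [_ _ _ /(_ x0) lex0] := xi_spec R G0.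
apply: pos; apply: le_lt_trans xx; apply: lex0.
by rewrite indep_polyE rootE px0.
Qed.

Section PendantCore.
Variables (G : sgraph) (C : {set G}) (lf : G -> G).
Hypothesis core : pendant_core C lf.
Local Notation lfC := (proj1 core).
Local Notation Nlf := (proj2 core).

Lemma pendant_core_connected r : graph_connected G -> r \in C ->
  {in C, forall z, connect (edge_in C) r z}.
Proof.
move=> conG rC z zC.
(* [P y] says that [y], or the core vertex to which it is attached, is reached inside the core; a
   walk through a pendant vertex returns to where it came from. *)
pose P y := connect (edge_in C) r y ||
  [exists c in C, (y == lf c) && connect (edge_in C) r c].
have Pcore y : y \in C -> P y -> connect (edge_in C) r y.
  move=> yC /orP[//|/exists_inP[c cC /andP[/eqP yE _]]].
  by move: (pendant_notin core cC); rewrite -yE yC.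
apply: (Pcore) => //.
apply: (connect_invariant (P := P) _ (conG r z)); last by rewrite /P connect0.
move=> a b ab Pa; have [aC|aC] := boolP (a \in C).
  have ra := Pcore a aC Pa; have [bC|bC] := boolP (b \in C).
    apply/orP; left; apply: connect_trans ra (connect1 _).
    by rewrite /edge_in aC bC.
  move: bC; rewrite -in_setC -lfC => /imsetP[c cC bE].
  apply/orP; right; apply/exists_inP; exists c; rewrite // bE eqxx /=.
  by move: ab; rewrite bE sedge_sym Nlf // => /eqP <-.
case/orP: Pa => [ra|/exists_inP[c cC /andP[/eqP aE rc]]].
  case/negP: aC; apply: (connect_invariant (P := mem C) _ ra) => //.
  by move=> ? ? /and3P[].
by move: ab; rewrite aE Nlf // => /eqP ->; rewrite /P rc.
Qed.

Lemma pendant_core_iso (H : sgraph) (f : H -> G) : injective f ->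
  f @: setT = C -> {mono f : x y / sedge x y} -> graph_iso G (graph_star H).
Proof.
move=> fI fC fE; have fin v : f v \in C by rewrite -fC imset_f.
pose h (a : graph_star H) : G := match a with inl v => f v | inr v => lf (f v) end.
have hI : injective h.
  move=> [u|u] [v|v] /= e; first by rewrite (fI _ _ e).
  - by have := pendant_notin core (fin v); rewrite -e fin.
  - by have := pendant_notin core (fin u); rewrite e fin.
  - by rewrite (fI _ _ (pendant_inj core (fin u) (fin v) e)).
have hE : {mono h : x y / sedge x y}.
  move=> [u|u] [v|v] /=; first exact: fE.
  - by rewrite sedge_sym Nlf // (inj_eq fI).
  - by rewrite Nlf // (inj_eq fI) eq_sym.
  - by rewrite Nlf //; apply: contraTF (pendant_notin core (fin v)) => /eqP ->; rewrite negbK.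
have cC : #|C| = #|H| by rewrite -fC card_imset // cardsT.
have [g hK gK] : bijective h.
  by apply: inj_card_bij => //; rewrite (card_pendant_core core) cC card_sum mul2n addnn.
by exists g; [exists h|move=> x y; rewrite -{2}(gK x) -{2}(gK y) hE].
Qed.

Lemma ipoly_pendant_core (R : realType) (x : R) : 0 < 1 + x ->
  (indep_poly R G).[x] = (1 + x) ^+ #|C| * (ipoly R C).[x / (1 + x)].
Proof.
by move=> x1; rewrite indep_polyE -(ipoly_pendant core) ?gt_eqF // lfC setUCr.
Qed.

(** By [ipoly_pendant], a set [U] with its pendant vertices has at [x] a positive multiple of the
    value of [U] at [x / (1 + x)]. Single vertices yield the signs of [1 + x] and
    [1 + x / (1 + x)]. *)
Lemma pendant_core_positive (R : realType) (x : R) :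
  (0 < #|C|)%N -> xi R G < x < 0 ->
  [/\ 0 < 1 + x, x / (1 + x) < 0, 0 < 1 + x / (1 + x) &
    forall U : {set G}, U \subset C -> 0 < (ipoly R U).[x / (1 + x)]].
Proof.
move=> /card_gt0P[c cC] /andP[xx x0].
have G0 : (0 < #|G|)%N by apply/card_gt0P; exists c.
have pos := ipoly_gt_xi G0 xx.
have single y : (ipoly R [set c]).[y] = 1 + y.
  rewrite ipoly_independent ?cards1 ?expr1 //.
  by apply/independentP => u v /set1P -> /set1P ->; rewrite sedge_irrefl.
have x1 : 0 < 1 + x by rewrite -single.
have posU (U : {set G}) : U \subset C -> 0 < (ipoly R U).[x / (1 + x)].
  move=> UC; have := pos (U :|: lf @: U).
  rewrite (ipoly_pendant core) ?gt_eqF //.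
  by rewrite pmulr_rgt0 // exprn_gt0.
split=> //; first by rewrite pmulr_llt0 ?invr_gt0.
by rewrite -single; apply: posU; rewrite sub1set.
Qed.

End PendantCore.

(** * Cores of the graph stars of paths and stars *)

Section GraphStarCore.
Variable H : sgraph.

Definition star_core : {set graph_star H} :=
  [set a | if a is inl _ then true else false].

Definition star_leaf (a : graph_star H) : graph_star H :=
  match a with inl v => inr v | inr v => inl v end.

Lemma star_pendant_core : pendant_core star_core star_leaf.
Proof.
split.
  apply/setP => -[v|v]; rewrite !inE /=.
    by apply/imsetP => -[[w|w]]; rewrite !inE.
  by apply/imsetP; exists (inl v); rewrite ?inE.
by move=> [v|v]; rewrite !inE // => _ [w|w].
Qed.

Lemma card_star_core : #|star_core| = #|H|.
Proof.
apply/eqP; rewrite -(eqn_pmul2l (m := 2)) //.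
by rewrite -(card_pendant_core star_pendant_core) card_sum mul2n addnn.
Qed.
End GraphStarCore.

Lemma ipoly_path_star (F : comNzRingType) (x : F) n :
  (ipoly F (star_core (path_graph n))).[x] = path_val x n.+2.
Proof.
pose l : seq (graph_star (path_graph n)) := [seq inl i | i <- enum 'I_n].
have sl : size l = n by rewrite size_map size_enum_ord.
have -> : star_core (path_graph n) = [set z in l].
  apply/setP => -[v|v]; rewrite !inE /=; apply/esym/mapP.
    by exists v; rewrite ?mem_enum.
  by case.
rewrite ipoly_induced_path ?sl //; split.
  by rewrite map_inj_uniq ?enum_uniq // => i j [].
rewrite sl => x0 i j li lj.
have lE k (lk : (k < n)%N) : nth x0 l k = inl (Ordinal lk).
  rewrite (nth_map (Ordinal lk)) ?size_enum_ord //; congr inl.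
  by apply: val_inj; apply: nth_enum_ord.
by rewrite (lE i li) (lE j lj).
Qed.

Lemma ipoly_star_star (F : comNzRingType) (x : F) n : (0 < n)%N ->
  (ipoly F (star_core (star_graph n))).[x] = (1 + x) ^+ n.-1 + x.
Proof.
case: n => // n _; set C := star_core _.
pose u : graph_star (star_graph n.+1) := inl ord0.
have uC : u \in C by rewrite inE.
have cC : #|C :\ u| = n.
  by have := cardsD1 u C; rewrite uC card_star_core card_ord add1n => -[].
rewrite -(setD1K uC) ipoly_star ?cC //.
- by rewrite !inE eqxx.
- apply/independentP => -[v|v] [w|w]; rewrite !inE //= /center_edge.
  have nu z : (inl z != u) -> (z == 0 :> nat)%N = false.
    by apply: contraNF => /eqP z0; apply/eqP; congr inl; apply: val_inj.
  by rewrite !andbT => /nu -> /nu ->.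
- move=> [w|w]; rewrite !inE //= /center_edge andbT => nw.
  by apply: contraNN nw => /eqP z0; apply/eqP; congr inl; apply: val_inj.
Qed.

Lemma path_pendant_core_iso (T : sgraph) (lf : T -> T) (l : seq T) (x0 : T) :
  pendant_core [set z in l] lf -> induced_path l ->
  graph_iso T (graph_star (path_graph (size l))).
Proof.
move=> core [ul hl]; set n := size _.
pose f (i : path_graph n) : T := nth x0 l (val (i : 'I_n)).
apply: (pendant_core_iso core (f := f)).
- move=> i j /eqP; rewrite /f nth_uniq // => [/eqP/val_inj//||]; exact: ltn_ord.
- apply/setP => z; rewrite [RHS]inE; apply/imsetP/idP => [[i _ ->]|zl].
    by rewrite mem_nth // ltn_ord.
  have iz : (index z l < n)%N by rewrite index_mem.
  by exists (Ordinal iz); rewrite // /f nth_index.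
- by move=> i j; rewrite /f hl ?ltn_ord.
Qed.

(** Listing [u] first sends the vertex 0, the centre of [star_graph], to [u]. *)
Lemma star_pendant_core_iso (T : sgraph) (lf : T -> T) (C : {set T}) u :
  pendant_core C lf -> u \in C -> independent (C :\ u) ->
  {in C :\ u, forall z, sedge u z} -> graph_iso T (graph_star (star_graph #|C|)).
Proof.
move=> core uC iC Nu; pose l := u :: enum (C :\ u).
have sl : size l = #|C| by rewrite /= -cardE (cardsD1 u C) uC.
have ul : uniq l by rewrite /= mem_enum !inE eqxx enum_uniq.
pose f (i : star_graph #|C|) : T := nth u l (val (i : 'I_#|C|)).
have ltl (i : 'I_#|C|) : (i < size l)%N by rewrite sl ltn_ord.
have fu (i : 'I_#|C|) : i = 0 :> nat -> f i = u.
  by move=> i0; rewrite /f (i0 : val i = 0%N).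
have fW (i : 'I_#|C|) : i <> 0 :> nat -> f i \in C :\ u.
  rewrite -mem_enum /f; have := ltl i.
  change (nat_of_ord i) with (val i); case: (val i) => //= k lk _.
  exact: mem_nth.
apply: (pendant_core_iso core (f := f)).
- by move=> i j /eqP; rewrite /f nth_uniq ?ltl // => /eqP/val_inj.
- apply/setP => z; apply/imsetP/idP => [[i _ ->]|zC].
    have : f i \in l by apply: mem_nth; exact: ltl.
    rewrite inE mem_enum => /orP[/eqP ->//|].
    by rewrite inE => /andP[].
  have zl : z \in l by rewrite inE mem_enum !inE zC andbT orbN.
  have iz : (index z l < #|C|)%N by rewrite -sl index_mem.
  by exists (Ordinal iz); rewrite // /f nth_index.
- move=> i j; rewrite /= /center_edge; case: eqP => [i0|i0]; case: eqP => [j0|j0] /=.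
  + by rewrite (fu i i0) (fu j j0) sedge_irrefl.
  + by rewrite (fu i i0) (Nu _ (fW j j0)).
  + by rewrite (fu j j0) sedge_sym (Nu _ (fW i i0)).
  + by apply/negbTE; apply: (independentP _ iC); apply: fW.
Qed.

(** Continuity covers the end points, and the polynomials differ because their values at [xi / 2]
    do. *)
Lemma prec_of_strict (R : realType) (H G : sgraph) : (0 < #|G|)%N ->
  (forall x : R, xi R G < x < 0 -> (indep_poly R G).[x] < (indep_poly R H).[x]) ->
  prec R H G.
Proof.
move=> G0 lt; have [_ _ /andP[_ xi0] _] := xi_spec R G0.
split; first by apply: poly_le_closed => // x /lt/ltW.
move=> e; have := lt (xi R G / 2); rewrite e ltxx => h.
by apply/notF/h; apply/andP; split; lra.
Qed.

Lemma connected_neighbour (G : sgraph) (C : {set G}) r : (1 < #|C|)%N ->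
  {in C, forall z, connect (edge_in C) r z} ->
  {in C, forall z, exists2 w, w \in C & sedge z w}.
Proof.
move=> C1 conC z zC; have [w /andP[wC zw]|noN] := pickP [pred w in C | sedge z w].
  by exists w.
move: C1; rewrite (cardsD1 z) zC ltnS => /card_gt0P[w].
rewrite !inE => /andP[wz wC].
have zw : connect (edge_in C) z w.
  by rewrite (connect_trans _ (conC w wC)) // edge_in_sym conC.
have : pred1 z w.
  apply: (connect_invariant (P := pred1 z) _ zw); last by rewrite /= eqxx.
  by move=> a b /and3P[_ bC ab] /eqP az; have := noN b; rewrite /= bC -az ab.
by rewrite /= (negPf wz).
Qed.

Theorem corollary3p7 (R : realType) (n : nat) (T : sgraph)
    (T_tree : is_tree T) (T_wc : well_covered T) (T_order : #|T| = (2 * n)%N)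
    (T_nP : ~ graph_iso T (graph_star (path_graph n)))
    (T_nS : ~ graph_iso T (graph_star (star_graph n))) :
  prec R (graph_star (path_graph n)) T /\ prec R T (graph_star (star_graph n)).
Proof.
have [T0 conT acT] := T_tree.
have n0 : (0 < n)%N by move: T0; rewrite T_order muln_gt0.
have T2 : (1 < #|T|)%N by rewrite T_order mul2n -addnn -addn1 leq_add.
have [C [lf core]] := well_covered_pendant_core T_tree T_wc T2.
have cC : #|C| = n.
  by apply/eqP; rewrite -(eqn_pmul2l (m := 2)) // -T_order (card_pendant_core core).
have C0 : (0 < #|C|)%N by rewrite cC.
have [r rC] : exists r, r \in C by apply/card_gt0P.
have conC := pendant_core_connected core conT rC.
have cP := card_star_core (path_graph n); rewrite card_ord in cP.
have cS := card_star_core (star_graph n); rewrite card_ord in cS.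
split; apply: prec_of_strict => //.
- move=> x xx; have [x1 y0 y1 pos] := pendant_core_positive core C0 xx.
  have tC := connected_rooted_tree acT rC conC.
  have [le _ eq_path _] := tree_le_path y0 tC pos.
  rewrite (ipoly_pendant_core core x1) (ipoly_pendant_core (star_pendant_core _) x1).
  rewrite cP cC ipoly_path_star ltr_pM2l ?exprn_gt0 //.
  rewrite cC in le eq_path; rewrite lt_neqAle le andbT; apply/eqP => /eq_path[l hl CE].
  have sl : size l = n by rewrite -cC CE cardsE (card_uniqP hl.1).
  rewrite CE in core.
  by apply: T_nP; rewrite -sl; apply: path_pendant_core_iso r core hl.
- by rewrite card_sum /= card_ord addn_gt0 n0.
- move=> x xx.
  have [|x1 y0 y1 pos] := pendant_core_positive (star_pendant_core (star_graph n)) _ xx.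
    by rewrite cS.
  rewrite (ipoly_pendant_core core x1) (ipoly_pendant_core (star_pendant_core _) x1).
  rewrite cS cC ipoly_star_star // ltr_pM2l ?exprn_gt0 //.
  (* To the right of this [xi], positivity is known for the star and not for [T]; it is the input of
     [forest_ge_star]. *)
  have := pos _ (subxx _); rewrite ipoly_star_star // => /ltW star_ge0.
  have [|le _] := forest_ge_star y0 y1 (n := n) (U := C) acT star_ge0.
    by rewrite cC n0 leqnn.
  rewrite cC in le; rewrite lt_neqAle le andbT; apply/eqP => eq_star.
  apply: T_nS; rewrite -cC.
  (* A core with one vertex has no leaf with a neighbour, but is itself a star with centre [r]. *)
  have [n1|n1] := leqP n 1.
    have Cr : C :\ r = set0.
      by apply/eqP; rewrite -cards_eq0; have := cardsD1 r C; rewrite rC cC; lia.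
    apply: star_pendant_core_iso core rC _ _; rewrite Cr.
      by apply/independentP => z w; rewrite inE.
    by move=> z; rewrite inE.
  rewrite -cC in n1 star_ge0 eq_star.
  have [u [uC iC Nu]] := tree_eq_star y0 y1 acT n1 (connected_neighbour n1 conC)
    star_ge0 (esym eq_star).
  exact: star_pendant_core_iso core uC iC Nu.
Qed.
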